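(* Let $\varphi\colon\mathcal{B}\to\mathcal{C}$ be a nondegenerate homomorphism of $C^*$-algebras, let $E$ be a Hilbert $\mathcal{B}$-module and $F$ a Hilbert $\mathcal{C}$-module, and denote by $i_\varphi$ the canonical map $E\to E\odot{}_\varphi\mathcal{C}$. Let $a\colon E\to F$ be a bounded $\varphi$-linear map. Then $$a'\colon x\odot c\longmapsto (ax)c$$ defines a $\mathcal{C}$-linear operator from the algebraic tensor product $E\,\underline{\odot}\,{}_\varphi\mathcal{C}$ into $F$ such that $a=a'i_\varphi$ (and $a'$ is uniquely determined by this property if $i_\varphi$ is surjective). Moreover, if $a$ is $\varphi$-adjointable or if $\varphi(\mathcal{B})$ is an ideal in $\mathcal{C}$, then $a'$ extends to a bounded right $\mathcal{C}$-linear operator $E\odot{}_\varphi\mathcal{C}\to F$ (also denoted by $a'$) with norm $\|a'\|\le\|a\|$; in the case where $a$ is $\varphi$-adjointable, $a'$ is adjointable.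
   Context: Homomorphisms of $C^*$-algebras are $*$-homomorphisms; $\varphi$ is nondegenerate if $\varphi(\mathcal{B})\mathcal{C}$ is total in $\mathcal{C}$. Inner products of Hilbert modules are linear in the second argument. ${}_\varphi\mathcal{C}$ is the Hilbert $\mathcal{C}$-module $\mathcal{C}$ (with $\langle c,c'\rangle=c^*c'$) with left action $bc:=\varphi(b)c$ of $\mathcal{B}$. $E\,\underline{\odot}\,{}_\varphi\mathcal{C}$ is the algebraic tensor product over $\mathcal{B}$ and $E\odot{}_\varphi\mathcal{C}$ its completion, the interior tensor product, with $\langle x\odot c,x'\odot c'\rangle=c^*\varphi(\langle x,x'\rangle)c'$. The canonical map $i_\varphi\colon E\to E\odot{}_\varphi\mathcal{C}$ is the well-defined contraction determined by $i_\varphi(xb)=x\odot\varphi(b)$ ($x\in E$, $b\in\mathcal{B}$); since $E=E\mathcal{B}$, it takes values in the algebraic tensor product. An additive map $a\colon E\to F$ is $\varphi$-linear if $a(xb)=(ax)\varphi(b)$ for all $x\in E$, $b\in\mathcal{B}$. A map $a\colon E\to F$ is $\varphi$-adjointable if there is a linear map $a^*\colon F\to E$ with $\langle ax,y\rangle=\varphi(\langle x,a^*y\rangle)$ for all $x\in E$, $y\in F$. *)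

(* Defs.v *)
(* Complex scalars are R[i] for R : realType, so norms take their values in
   R[i] (as nonnegative real elements). *)
From HB Require Import structures.
From mathcomp Require Import all_boot all_order all_algebra.
From mathcomp Require Import complex.
From mathcomp Require Import all_classical all_reals all_analysis.

Set Implicit Arguments.
Unset Strict Implicit.
Unset Printing Implicit Defensive.

Import Order.TTheory GRing.Theory Num.Theory.
Import numFieldNormedType.Exports.
Local Open Scope classical_set_scope.
Local Open Scope ring_scope.
Local Open Scope quotient_scope.

Declare Scope cstar_scope.
Delimit Scope cstar_scope with cstar.

(* Not necessarily unital: MathComp rings have a unit, so the product is an
   operation of its own. *)
HB.mixin Record CompleteNormedModule_isCStarAlgebra (R : realType) A
    of CompleteNormedModule R[i] A := {
  cmul : A -> A -> A;
  cstar : A -> A;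
  cmulA : associative cmul;
  cmulDl : left_distributive cmul +%R;
  cmulDr : right_distributive cmul +%R;
  cmulZl : forall (k : R[i]) (a b : A), cmul (k *: a) b = k *: cmul a b;
  cmulZr : forall (k : R[i]) (a b : A), cmul a (k *: b) = k *: cmul a b;
  cmul_norm : forall a b : A, `|cmul a b| <= `|a| * `|b|;
  cstarK : involutive cstar;
  cstarD : {morph cstar : a b / a + b};
  cstarZ : forall (k : R[i]) (a : A), cstar (k *: a) = Num.conj k *: cstar a;
  cstarM : forall a b : A, cstar (cmul a b) = cmul (cstar b) (cstar a);
  cstar_norm : forall a : A, `|cmul (cstar a) a| = `|a| ^+ 2
}.

#[short(type="cstarAlgType")]
HB.structure Definition CStarAlgebra (R : realType) :=
  {A of CompleteNormedModule R[i] A & CompleteNormedModule_isCStarAlgebra R A}.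

Notation "a ** b" := (cmul a b) (at level 40, left associativity) : cstar_scope.
Local Open Scope cstar_scope.

Definition cpositive (R : realType) (A : cstarAlgType R) (a : A) : Prop :=
  exists b : A, a = cstar b ** b.

HB.mixin Record Lmodule_isRightModule (R : realType) (B : cstarAlgType R) E
    of GRing.Lmodule R[i] E := {
  ract : E -> B -> E;
  ractDl : forall (x y : E) (b : B), ract (x + y) b = ract x b + ract y b;
  ractDr : forall (x : E) (b c : B), ract x (b + c) = ract x b + ract x c;
  ractZl : forall (k : R[i]) (x : E) (b : B), ract (k *: x) b = k *: ract x b;
  ractZr : forall (k : R[i]) (x : E) (b : B), ract x (k *: b) = k *: ract x b;
  ractA : forall (x : E) (b c : B), ract (ract x b) c = ract x (b ** c)
}.

#[short(type="rightModType")]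
HB.structure Definition RightModule (R : realType) (B : cstarAlgType R) :=
  {E of GRing.Lmodule R[i] E & Lmodule_isRightModule R B E}.

Notation "x |> b" := (ract x b) (at level 40, left associativity) : cstar_scope.

(* Definiteness of the inner product is a consequence of inner_norm. *)
HB.mixin Record RightModule_isHilbertModule (R : realType) (B : cstarAlgType R)
    E of CompleteNormedModule R[i] E & RightModule R B E := {
  inner : E -> E -> B;
  innerDr : forall x y z : E, inner x (y + z) = inner x y + inner x z;
  innerZr : forall (k : R[i]) (x y : E), inner x (k *: y) = k *: inner x y;
  inner_ract : forall (x y : E) (b : B), inner x (y |> b) = inner x y ** b;
  inner_star : forall x y : E, cstar (inner x y) = inner y x;
  inner_ge0 : forall x : E, cpositive (inner x x);
  inner_norm : forall x : E, `|x| ^+ 2 = `|inner x x|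
}.

#[short(type="hilbertModType")]
HB.structure Definition HilbertModule (R : realType) (B : cstarAlgType R) :=
  {E of CompleteNormedModule R[i] E & RightModule R B E
      & RightModule_isHilbertModule R B E}.

Notation "⟨ x , y ⟩" := (inner x y) (at level 0, x, y at level 99)
  : cstar_scope.

Definition lin_span (K : numFieldType) (V : lmodType K) (S : set V) : set V :=
  [set v | exists2 s : seq (K * V),
     (forall p, p \in s -> S p.2) & v = \sum_(p <- s) p.1 *: p.2].

Definition total_in (K : numFieldType) (V : normedModType K) (S : set V)
  : Prop := dense (lin_span S).

Definition bounded_map (K : numFieldType) (V W : normedModType K) (f : V -> W)
  : Prop := exists M : K, forall x, `|f x| <= M * `|x|.

Definition opnorm (R : realType) (V W : normedModType R[i]) (f : V -> W) : R :=
  sup [set complex.Re `|f x| | x in [set x : V | `|x| <= 1]].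

Section Maps.
Variables (R : realType) (B C : cstarAlgType R).

Definition is_star_hom (phi : B -> C) : Prop :=
  [/\ linear phi, {morph phi : a b / a ** b}
    & {morph phi : a / cstar a}].

Definition nondegenerate_hom (phi : B -> C) : Prop :=
  total_in [set d : C | exists b c, d = phi b ** c].

Definition two_sided_ideal (I : set C) : Prop :=
  [/\ I 0, (forall x y, I x -> I y -> I (x + y)),
      (forall (k : R[i]) x, I x -> I (k *: x))
    & (forall x c, I x -> I (c ** x) /\ I (x ** c))].

(* With phi := id this is right C-linearity of additive maps. *)
Definition phi_linear (phi : B -> C) (E : rightModType B) (F : rightModType C)
    (a : E -> F) : Prop :=
  {morph a : x y / x + y} /\ forall x b, a (x |> b) = a x |> phi b.

(* With phi := id this is adjointability of maps of Hilbert C-modules. *)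
Definition phi_adjointable (phi : B -> C) (E : hilbertModType B)
    (F : hilbertModType C) (a : E -> F) : Prop :=
  exists astar : {linear F -> E},
    forall x y, ⟨a x, y⟩ = phi ⟨x, astar y⟩.

End Maps.

Section AlgebraicTensor.
Variables (R : realType) (B C : cstarAlgType R) (phi : B -> C).
Variable E : rightModType B.

(* A list of pairs (x, c) stands for the finite sum of the x (.) c; the
   algebraic tensor product over B of E and the B-C-bimodule _phi C is the
   quotient of these formal sums by the congruence below. *)
Inductive tensor_eq : seq (E * C) -> seq (E * C) -> Prop :=
| tensor_eq_refl s : tensor_eq s s
| tensor_eq_sym s t : tensor_eq s t -> tensor_eq t s
| tensor_eq_trans t s u : tensor_eq s t -> tensor_eq t u -> tensor_eq s u
| tensor_eq_cat s s' t t' :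
    tensor_eq s s' -> tensor_eq t t' -> tensor_eq (s ++ t) (s' ++ t')
| tensor_eq_catC s t : tensor_eq (s ++ t) (t ++ s)
| tensor_eq0 c : tensor_eq [:: (0, c)] [::]
| tensor_eqDl x y c : tensor_eq [:: (x + y, c)] [:: (x, c); (y, c)]
| tensor_eqDr x c d : tensor_eq [:: (x, c + d)] [:: (x, c); (x, d)]
| tensor_eqZ k x c : tensor_eq [:: (k *: x, c)] [:: (x, k *: c)]
| tensor_eqB x b c : tensor_eq [:: (x |> b, c)] [:: (x, phi b ** c)].

Definition tensor_rel : rel (seq (E * C)) := [rel s t | `[< tensor_eq s t >]].

Lemma tensor_rel_refl : reflexive tensor_rel.
Proof. by move=> s; apply/asboolP; exact: tensor_eq_refl. Qed.

Lemma tensor_rel_sym : symmetric tensor_rel.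
Proof.
by move=> s t; apply/asboolP/asboolP => ?; exact: tensor_eq_sym.
Qed.

Lemma tensor_rel_trans : transitive tensor_rel.
Proof.
by move=> t s u /asboolP st /asboolP tu; apply/asboolP; exact: tensor_eq_trans tu.
Qed.

Canonical tensor_equiv :=
  EquivRel tensor_rel tensor_rel_refl tensor_rel_sym tensor_rel_trans.

Definition atensor : Type := {eq_quot tensor_equiv}.
HB.instance Definition _ := Choice.on atensor.
HB.instance Definition _ := Quotient.on atensor.

Definition tsum (s : seq (E * C)) : atensor := \pi_atensor s.

Lemma tsumP s t : tsum s = tsum t <-> tensor_eq s t.
Proof.
split=> [/eqP|st]; first by rewrite /tsum eqmodE => /asboolP.
by apply/eqP; rewrite /tsum eqmodE; apply/asboolP.
Qed.

Lemma repr_tsum s : tensor_eq (repr (tsum s)) s.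
Proof. by apply/tsumP; rewrite /tsum reprK. Qed.

Lemma tsum_ind (P : atensor -> Prop) : (forall s, P (tsum s)) -> forall t, P t.
Proof. by move=> Ps t; rewrite -[t]reprK; exact: Ps. Qed.

Definition tensor (x : E) (c : C) : atensor := tsum [:: (x, c)].

Definition tscale_seq (k : R[i]) (s : seq (E * C)) :=
  [seq (k *: p.1, p.2) | p <- s].
Definition tact_seq (s : seq (E * C)) (d : C) :=
  [seq (p.1, p.2 ** d) | p <- s].

Definition tadd (s t : atensor) := tsum (repr s ++ repr t).
Definition tscale (k : R[i]) (t : atensor) := tsum (tscale_seq k (repr t)).
Definition topp (t : atensor) := tscale (-1) t.
Definition tact (t : atensor) (d : C) := tsum (tact_seq (repr t) d).

Lemma tscale_seq_eq k s t :
  tensor_eq s t -> tensor_eq (tscale_seq k s) (tscale_seq k t).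
Proof.
elim=> {s t} /=.
- by move=> s; exact: tensor_eq_refl.
- by move=> s t _; exact: tensor_eq_sym.
- by move=> t s u _ st _; exact: tensor_eq_trans.
- move=> s s' t t' _ ss _ tt.
  by rewrite /tscale_seq !map_cat; exact: tensor_eq_cat.
- by move=> s t; rewrite /tscale_seq !map_cat; exact: tensor_eq_catC.
- by move=> c; rewrite scaler0; exact: tensor_eq0.
- by move=> x y c; rewrite scalerDr; exact: tensor_eqDl.
- by move=> x c d; exact: tensor_eqDr.
- by move=> l x c; rewrite scalerA mulrC -scalerA; exact: tensor_eqZ.
- by move=> x b c; rewrite -ractZl; exact: tensor_eqB.
Qed.

Lemma tact_seq_eq d s t :
  tensor_eq s t -> tensor_eq (tact_seq s d) (tact_seq t d).
Proof.
elim=> {s t} /=.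
- by move=> s; exact: tensor_eq_refl.
- by move=> s t _; exact: tensor_eq_sym.
- by move=> t s u _ st _; exact: tensor_eq_trans.
- move=> s s' t t' _ ss _ tt.
  by rewrite /tact_seq !map_cat; exact: tensor_eq_cat.
- by move=> s t; rewrite /tact_seq !map_cat; exact: tensor_eq_catC.
- by move=> c; exact: tensor_eq0.
- by move=> x y c; exact: tensor_eqDl.
- by move=> x c e; rewrite cmulDl; exact: tensor_eqDr.
- by move=> l x c; rewrite cmulZl; exact: tensor_eqZ.
- by move=> x b c; rewrite -cmulA; exact: tensor_eqB.
Qed.

Lemma tadd_tsum s t : tadd (tsum s) (tsum t) = tsum (s ++ t).
Proof. by apply/tsumP; apply: tensor_eq_cat; exact: repr_tsum. Qed.

Lemma tscale_tsum k s : tscale k (tsum s) = tsum (tscale_seq k s).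
Proof. by apply/tsumP; apply: tscale_seq_eq; exact: repr_tsum. Qed.

Lemma tact_tsum s d : tact (tsum s) d = tsum (tact_seq s d).
Proof. by apply/tsumP; apply: tact_seq_eq; exact: repr_tsum. Qed.

Lemma taddA : associative tadd.
Proof.
elim/tsum_ind => s; elim/tsum_ind => t; elim/tsum_ind => u.
by rewrite !tadd_tsum catA.
Qed.

Lemma taddC : commutative tadd.
Proof.
elim/tsum_ind => s; elim/tsum_ind => t; rewrite !tadd_tsum.
by apply/tsumP; exact: tensor_eq_catC.
Qed.

Lemma tadd0 : left_id (tsum [::]) tadd.
Proof. by elim/tsum_ind => s; rewrite tadd_tsum. Qed.

Lemma tscaleDr k : {morph tscale k : s t / tadd s t}.
Proof.
elim/tsum_ind => s; elim/tsum_ind => t.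
by rewrite !(tadd_tsum, tscale_tsum) /tscale_seq map_cat.
Qed.

Lemma tactDl d : {morph tact^~ d : s t / tadd s t}.
Proof.
elim/tsum_ind => s; elim/tsum_ind => t.
by rewrite !(tadd_tsum, tact_tsum) /tact_seq map_cat.
Qed.

Lemma tsum_cons x c s : tsum ((x, c) :: s) = tadd (tensor x c) (tsum s).
Proof. by rewrite tadd_tsum. Qed.

Lemma taddACA : interchange tadd tadd.
Proof. by move=> s t u v; rewrite -!taddA (taddA t) (taddC t) -taddA. Qed.

Lemma tscale_tensor k x c : tscale k (tensor x c) = tensor (k *: x) c.
Proof. by rewrite tscale_tsum. Qed.

Lemma tensorDl x y c : tensor (x + y) c = tadd (tensor x c) (tensor y c).
Proof. by rewrite tadd_tsum; apply/tsumP; exact: tensor_eqDl. Qed.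

Lemma tensorDr x c d : tensor x (c + d) = tadd (tensor x c) (tensor x d).
Proof. by rewrite tadd_tsum; apply/tsumP; exact: tensor_eqDr. Qed.

Lemma tensorZ k x c : tensor (k *: x) c = tensor x (k *: c).
Proof. by apply/tsumP; exact: tensor_eqZ. Qed.

Lemma tensorB x b c : tensor (x |> b) c = tensor x (phi b ** c).
Proof. by apply/tsumP; exact: tensor_eqB. Qed.

Lemma tact_tensor x c d : tact (tensor x c) d = tensor x (c ** d).
Proof. by rewrite tact_tsum. Qed.

Lemma tscale_nil k : tscale k (tsum [::]) = tsum [::].
Proof. by rewrite tscale_tsum. Qed.

Lemma tact_nil d : tact (tsum [::]) d = tsum [::].
Proof. by rewrite tact_tsum. Qed.

Lemma tscaleDl t k l : tscale (k + l) t = tadd (tscale k t) (tscale l t).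
Proof.
elim/tsum_ind: t; elim=> [|[x c] s IH]; first by rewrite !tscale_nil tadd0.
by rewrite tsum_cons !tscaleDr IH !tscale_tensor scalerDl tensorDl taddACA.
Qed.

Lemma tscaleA k l t : tscale k (tscale l t) = tscale (k * l) t.
Proof.
elim/tsum_ind: t; elim=> [|[x c] s IH]; first by rewrite !tscale_nil.
by rewrite tsum_cons !tscaleDr IH !tscale_tensor scalerA.
Qed.

Lemma tscale1 : left_id 1 tscale.
Proof.
elim/tsum_ind; elim=> [|[x c] s IH]; first by rewrite !tscale_nil.
by rewrite tsum_cons !tscaleDr IH !tscale_tensor scale1r.
Qed.

Lemma taddN : left_inverse (tsum [::]) topp tadd.
Proof.
elim/tsum_ind => s; rewrite -[X in tadd _ X]tscale1 -tscaleDl addNr.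
elim: s => [|[x c] s IH]; first by rewrite tscale_nil.
rewrite tsum_cons tscaleDr IH tscale_tensor scale0r taddC tadd0.
by apply/tsumP; exact: tensor_eq0.
Qed.

HB.instance Definition _ := GRing.isZmodule.Build atensor taddA taddC tadd0 taddN.
HB.instance Definition _ := GRing.Zmodule_isLmodule.Build R[i] atensor
  tscaleA tscale1 tscaleDr (fun t => @tscaleDl t).

Lemma tactDl' (s t : atensor) d : tact (s + t) d = tact s d + tact t d.
Proof. exact: tactDl. Qed.

Lemma tactDr (t : atensor) c d : tact t (c + d) = tact t c + tact t d.
Proof.
elim/tsum_ind: t; elim=> [|[x e] s IH]; first by rewrite !tact_nil [RHS]tadd0.
rewrite tsum_cons !tactDl IH !tact_tensor cmulDr tensorDr; exact: taddACA.
Qed.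

Lemma tactZl k (t : atensor) d : tact (k *: t) d = k *: tact t d.
Proof.
elim/tsum_ind: t => s; rewrite -[k *: _]/(tscale _ _) -[RHS]/(tscale _ _).
by rewrite !(tscale_tsum, tact_tsum) /tact_seq /tscale_seq -!map_comp.
Qed.

Lemma tactZr k (t : atensor) d : tact t (k *: d) = k *: tact t d.
Proof.
rewrite -[RHS]/(tscale _ _); elim/tsum_ind: t.
elim=> [|[x e] s IH]; first by rewrite !tact_nil tscale_nil.
by rewrite tsum_cons !tactDl IH !tact_tensor tscaleDr tscale_tensor cmulZr tensorZ.
Qed.

Lemma tactA (t : atensor) c d : tact (tact t c) d = tact t (c ** d).
Proof.
elim/tsum_ind: t => s; rewrite !tact_tsum /tact_seq -map_comp; congr tsum.
by apply: eq_map => -[x e] /=; rewrite cmulA.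
Qed.

HB.instance Definition _ := Lmodule_isRightModule.Build R C atensor
  tactDl' tactDr tactZl tactZr tactA.

End AlgebraicTensor.

Section InteriorTensor.
Variables (R : realType) (B C : cstarAlgType R) (phi : B -> C).
Variable E : hilbertModType B.

(* H, together with iota, is a completion of the algebraic tensor product for
   the inner product c^* phi(<x, x'>) c' of x (.) c and x' (.) c'. *)
Record is_interior_tensor (H : hilbertModType C)
    (iota : {linear atensor phi E -> H}) : Prop := IsInteriorTensor {
  interior_inj : injective iota;
  interior_act : forall t c, iota (t |> c) = iota t |> c;
  interior_inner : forall x c x' c',
    ⟨iota (tensor phi x c), iota (tensor phi x' c')⟩
      = cstar c ** phi ⟨x, x'⟩ ** c';
  interior_dense : dense (range iota)
}.

(* Every element of E is of the form x |> b, so this determines i_phi. *)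
Definition is_canonical_map (i_phi : E -> atensor phi E) : Prop :=
  forall x b, i_phi (x |> b) = tensor phi x (phi b).

End InteriorTensor.

(* Main.v *)
(* The identity [‖d + i k d‖^2 = ‖d^* (d + k^2 d)‖], for [k] self-adjoint, shows
   that the resolvent [r = k^2 (1 + k^2)^-1] and [1 - r] are contractive, without
   any functional calculus. With [k] a multiple of [⟨x, x⟩] this gives
   approximate units, hence Cohen factorization [E = E B]: so [a] is linear and
   [i_phi] is everywhere determined. With [k] a high power of [⟨x, x⟩ / s] it
   gives the key estimate [‖a x‖^2 <= ‖a‖^2 ‖phi ⟨x, x⟩‖], that is
   [‖a x‖ <= ‖a‖ ‖i_phi x‖]. If [phi B] is an ideal, every tensor is some
   [i_phi x], so that this bounds [a']; if [a] is [phi]-adjointable, then [a'] has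
   the adjoint [i_phi a^*], bounded by [‖a‖] through the same estimate. *)
Require Import Defs.
From HB Require Import structures.
From mathcomp Require Import all_boot all_order all_algebra.
From mathcomp Require Import complex.
From mathcomp Require Import all_classical all_reals all_analysis.
From mathcomp Require Import ring lra.

Set Implicit Arguments.
Unset Strict Implicit.
Unset Printing Implicit Defensive.

Import Order.TTheory GRing.Theory Num.Theory.
Import numFieldNormedType.Exports.
Local Open Scope classical_set_scope.
Local Open Scope ring_scope.
Local Open Scope cstar_scope.

(** Norms are real elements of [R[i]]; their real parts lie in the ordered field [R], where suprema,
    limits and order arguments take place. *)
Definition rnorm (R : realType) (V : normedModType R[i]) (v : V) : R :=
  complex.Re `|v|.

Local Notation "⟦ v ⟧" := (rnorm v) (at level 0, v at level 99).
Local Notation "t %:C" := (real_complex _ t) : ring_scope.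

(** * Norms as real numbers *)

Section RealNorm.
Variable R : realType.
Implicit Types (V W : normedModType R[i]).

Lemma rnormE V (v : V) : `|v| = ⟦v⟧%:C.
Proof.
have := normr_ge0 v.
rewrite /rnorm; case: `|v| => a b. by rewrite lecE /= => /andP[/eqP-> _].
Qed.

Lemma rnorm_ge0 V (v : V) : 0 <= ⟦v⟧.
Proof. by rewrite -ler0c -rnormE normr_ge0. Qed.

Lemma rnorm0 V : ⟦0 : V⟧ = 0.
Proof. by rewrite /rnorm normr0. Qed.

Lemma rnorm_eq0 V (v : V) : ⟦v⟧ = 0 -> v = 0.
Proof. by move=> v0; apply/eqP; rewrite -normr_eq0 rnormE v0. Qed.

Lemma rnorm_le0 V (v : V) : ⟦v⟧ <= 0 -> v = 0.
Proof. by move=> v0; apply: rnorm_eq0; apply/le_anti; rewrite v0 rnorm_ge0. Qed.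

Lemma rnormD V (v w : V) : ⟦v + w⟧ <= ⟦v⟧ + ⟦w⟧.
Proof. by rewrite -lecR rmorphD /= -!rnormE ler_normD. Qed.

Lemma rnormN V (v : V) : ⟦- v⟧ = ⟦v⟧.
Proof. by rewrite /rnorm normrN. Qed.

Lemma rnormB V (v w : V) : ⟦v - w⟧ <= ⟦v⟧ + ⟦w⟧.
Proof. by rewrite -(rnormN w); exact: rnormD. Qed.

Lemma rnormBC V (v w : V) : ⟦v - w⟧ = ⟦w - v⟧.
Proof. by rewrite -opprB rnormN. Qed.

Lemma rnormZ V (k : R[i]) (v : V) : ⟦k *: v⟧ = complex.Re `|k| * ⟦v⟧.
Proof.
by rewrite {1}/rnorm normrZ rnormE normc_def /= mul0r subr0.
Qed.

Lemma rnormZr V (t : R) (v : V) : ⟦t%:C *: v⟧ = `|t| * ⟦v⟧.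
Proof. by rewrite rnormZ normc_def /= expr0n addr0 sqrtr_sqr. Qed.

Lemma rnormZi V (v : V) : ⟦'i *: v⟧ = ⟦v⟧.
Proof. by rewrite rnormZ normCi mul1r. Qed.

Lemma rnormDD V (v : V) : ⟦v + v⟧ = 2 * ⟦v⟧.
Proof.
have -> : v + v = (2 : R)%:C *: v by rewrite rmorph_nat scaler_nat mulr2n.
by rewrite rnormZr ger0_norm.
Qed.

Lemma rnorm_dist V (v w : V) : ⟦v⟧ <= ⟦v - w⟧ + ⟦w⟧.
Proof. by rewrite -{1}(subrK w v) rnormD. Qed.

Lemma conjr (t : R) : Num.conj (t%:C : R[i]) = t%:C.
Proof. by apply: conj_Creal; rewrite complex_real. Qed.

Lemma expr_small (q e : R) : 0 <= q < 1 -> 0 < e -> exists n, q ^+ n < e.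
Proof.
move=> /andP[q0 q1] e0.
have /cvgrPdist_lt /(_ e e0) [N _ /(_ N (leqnn _))] :
    (q ^+ n @[n --> \oo] --> (0 : R)).
  by apply: cvg_expr; rewrite ger0_norm.
by rewrite /= sub0r normrN ger0_norm ?exprn_ge0// => ?; exists N.
Qed.

Lemma rnorm_cvg_le0 (f : nat -> R) (x : R) :
  (f n @[n --> \oo] --> 0) -> (forall n, x <= f n) -> x <= 0.
Proof.
move=> f0 xf; rewrite -(cvg_lim (@Rhausdorff R) f0); apply: limr_ge.
  by apply/cvg_ex; exists 0.
exact: nearW.
Qed.

Lemma geometric_cvg (V : completeNormedModType R[i]) (u : nat -> V) (C q : R) :
    0 <= q < 1 -> (forall n, ⟦u n.+1 - u n⟧ <= C * q ^+ n) ->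
  exists l, ⟦u n - l⟧ @[n --> \oo] --> (0 : R).
Proof.
move=> /andP[q0 q1] uC.
have C0 : 0 <= C.
  by have := le_trans (rnorm_ge0 _) (uC 0%N); rewrite expr0 mulr1.
have uB n m : ⟦u (n + m)%N - u n⟧ <= C / (1 - q) * q ^+ n.
  have {}q1 : 0 < 1 - q by rewrite subr_gt0.
  (* The induction on [m] needs the exact partial geometric sum. *)
  suff : ⟦u (n + m)%N - u n⟧ <= C / (1 - q) * (q ^+ n - q ^+ (n + m)).
    move=> /le_trans; apply; apply: ler_wpM2l; first by rewrite divr_ge0// ltW.
    by rewrite gerBl exprn_ge0.
  elim: m => [|m IH]; first by rewrite addn0 !subrr rnorm0 mulr0.
  rewrite addnS -(subrK (u (n + m)%N) (u _.+1)) -addrA.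
  apply: (le_trans (rnormD _ _)); apply: (le_trans (lerD (uC _) IH)).
  rewrite exprS; set X := q ^+ (n + m); rewrite le_eqVlt; apply/orP; left.
  by apply/eqP; field; rewrite gt_eqF.
have cauchy_u : cauchy (u n @[n --> \oo]).
  apply/cauchyP => e e0.
  have [eR eE] : exists2 d : R, 0 < d & (d%:C : R[i]) = e.
    case: e e0 => a b; rewrite ltcE /= => /andP[/eqP-> a0]; by exists a.
  move=> eE'.
  (* The summand 1 keeps the divisor positive when [C] is 0. *)
  have K0 : 0 < C / (1 - q) + 1.
    by rewrite ltr_wpDl// divr_ge0// subr_ge0 ltW.
  have [|N qN] := @expr_small q (eR / (C / (1 - q) + 1)) _ (divr_gt0 eE K0).
    by rewrite q0.
  exists (u N); exists N => // n /= Nn.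
  rewrite -ball_normE /= -normrN opprB rnormE -eE' ltcR -(subnKC Nn).
  apply: (le_lt_trans (uB _ _)).
  move: qN; rewrite ltr_pdivlMr// => /(le_lt_trans _); apply.
  by rewrite mulrC ler_wpM2l ?exprn_ge0// lerDl.
have /cvg_ex [l ul] : cvg (u n @[n --> \oo]) by exact: cauchy_cvg.
exists l; apply/cvgrPdist_lt => e e0.
have e0C : 0 < (e%:C : R[i]) by rewrite ltcR.
move/cvgrPdist_lt/(_ _ e0C) : ul => [N _ Nu].
exists N => // n /Nu /=; rewrite rnormE ltcR sub0r normrN rnormBC.
by rewrite ger0_norm// rnorm_ge0.
Qed.

(** Banach's fixed point argument: the iterates [u n] are the partial sums of the Neumann series for
    [(1 - T)^-1 c]. *)
Lemma contraction_solve (V : completeNormedModType R[i]) (T : V -> V) (q : R) :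
    0 <= q < 1 -> (forall v w, T (v - w) = T v - T w) ->
    (forall v, ⟦T v⟧ <= q * ⟦v⟧) ->
  forall c, exists v, v = c + T v.
Proof.
move=> q01 TB Tq c; have q0 : 0 <= q by case/andP: q01.
pose u n := iter n (fun v => c + T v) 0.
have uS n : u n.+1 = c + T (u n) by [].
have uB n : ⟦u n.+1 - u n⟧ <= ⟦c + T 0⟧ * q ^+ n.
  elim: n => [|n IH]; first by rewrite uS subr0 expr0 mulr1.
  rewrite uS (uS n) opprD addrACA subrr add0r -TB.
  apply: (le_trans (Tq _)); rewrite exprS mulrCA.
  by rewrite ler_wpM2l.
have [l ul] := geometric_cvg q01 uB.
exists l; apply/eqP; rewrite -subr_eq0; apply/eqP/rnorm_le0.
have H : (⟦u n.+1 - l⟧ + q * ⟦u n - l⟧) @[n --> \oo] --> (0 : R).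
  rewrite -[X in _ --> X]addr0 -[X in _ --> _ + X](mulr0 q).
  apply: cvgD; last by apply: cvgM ul; exact: cvg_cst.
  by have := ul; rewrite -(cvg_shiftS (fun n => ⟦u n - l⟧)).
apply: (rnorm_cvg_le0 H) => n.
have -> : l - (c + T l) = (l - u n.+1) + T (u n - l).
  by rewrite TB uS !opprD !addrA subrK.
by apply: (le_trans (rnormD _ _)); rewrite rnormBC lerD.
Qed.

End RealNorm.

(** * Resolvents of self-adjoint elements *)

Section CStarAlgebra.
Variables (R : realType) (B : cstarAlgType R).
Implicit Types (b c d k r z : B).

Lemma cmulNl b c : (- b) ** c = - (b ** c).
Proof. by rewrite -scaleN1r cmulZl scaleN1r. Qed.

Lemma cmulNr b c : b ** (- c) = - (b ** c).
Proof. by rewrite -scaleN1r cmulZr scaleN1r. Qed.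

Lemma cmulBl b c d : (b - c) ** d = b ** d - c ** d.
Proof. by rewrite cmulDl cmulNl. Qed.

Lemma cmulBr b c d : b ** (c - d) = b ** c - b ** d.
Proof. by rewrite cmulDr cmulNr. Qed.

Lemma cstar0 : cstar (0 : B) = 0.
Proof. by apply: (addrI (cstar 0)); rewrite -cstarD !addr0. Qed.

Lemma cstarN b : cstar (- b) = - cstar b.
Proof. by rewrite -scaleN1r cstarZ rmorphN rmorph1 scaleN1r. Qed.

Lemma cstarB b c : cstar (b - c) = cstar b - cstar c.
Proof. by rewrite cstarD cstarN. Qed.

Lemma cstarZr (t : R) b : cstar (t%:C *: b) = t%:C *: cstar b.
Proof. by rewrite cstarZ conjr. Qed.

Lemma rnorm_cmul b c : ⟦b ** c⟧ <= ⟦b⟧ * ⟦c⟧.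
Proof. by rewrite -lecR rmorphM /= -!rnormE cmul_norm. Qed.

Lemma rnorm_cstar_mul b : ⟦cstar b ** b⟧ = ⟦b⟧ ^+ 2.
Proof.
by apply/complexI; rewrite -rnormE cstar_norm rnormE rmorphXn.
Qed.

Lemma rnorm_cstar b : ⟦cstar b⟧ = ⟦b⟧.
Proof.
have le c : ⟦c⟧ <= ⟦cstar c⟧.
  have [->|c0] := eqVneq ⟦c⟧ 0; first exact: rnorm_ge0.
  have {}c0 : 0 < ⟦c⟧ by rewrite lt_def c0 rnorm_ge0.
  by rewrite -(ler_pM2r c0) -expr2 -rnorm_cstar_mul rnorm_cmul.
by apply/le_anti; rewrite le andbT -{2}(cstarK b) le.
Qed.

Lemma rnorm_sq_sa k : cstar k = k -> ⟦k ** k⟧ = ⟦k⟧ ^+ 2.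
Proof. by move=> kk; rewrite -rnorm_cstar_mul kk. Qed.

(** The power [b^(2^j)]. Repeated squaring is used because the C*-identity makes the norm exactly
    multiplicative along it for self-adjoint [b]. *)
Definition csq (j : nat) b : B := iter j (fun z => z ** z) b.

Lemma csqS j b : csq j.+1 b = csq j b ** csq j b.
Proof. by []. Qed.

Lemma csq_sa j k : cstar k = k -> cstar (csq j k) = csq j k.
Proof. by move=> kk; elim: j => // j IH; rewrite csqS cstarM IH. Qed.

Lemma rnorm_csq j k : cstar k = k -> ⟦csq j k⟧ = ⟦k⟧ ^+ (2 ^ j).
Proof.
move=> kk; elim: j => [|j IH]; first by rewrite expn0 expr1.
by rewrite csqS rnorm_sq_sa ?csq_sa// IH -exprM expnSr.
Qed.

Lemma rnorm_csq_le j b : ⟦csq j b⟧ <= ⟦b⟧ ^+ (2 ^ j).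
Proof.
elim: j => [|j IH]; first by rewrite expn0 expr1.
rewrite csqS expnSr exprM expr2; apply: (le_trans (rnorm_cmul _ _)).
by rewrite ler_pM ?rnorm_ge0.
Qed.

Lemma csqZ j (t : R) b : csq j (t%:C *: b) = (t ^+ (2 ^ j))%:C *: csq j b.
Proof.
elim: j => [|j IH]; first by rewrite expn0 expr1.
by rewrite !csqS IH cmulZl cmulZr scalerA -rmorphM /= -expr2 -exprM expnSr.
Qed.

Lemma csq_comm j b z : z ** b = b ** z -> z ** csq j b = csq j b ** z.
Proof.
move=> zb; elim: j => // j IH.
by rewrite csqS cmulA IH -!cmulA IH.
Qed.

(** When this element is multiplied by its adjoint, the two cross terms cancel, because [k] is
    self-adjoint while ['i] is conjugated. *)
Lemma rnorm_sa_complex k d (s t : R) : cstar k = k ->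
  ⟦s%:C *: d + 'i *: (t%:C *: (k ** d))⟧ ^+ 2
    = ⟦(s ^+ 2)%:C *: (cstar d ** d)
       + (t ^+ 2)%:C *: (cstar (k ** d) ** (k ** d))⟧.
Proof.
move=> kk; rewrite -rnorm_cstar_mul; congr rnorm.
rewrite cstarD !cstarZ !conjr conjCi cstarM kk scaleNr.
rewrite cmulBl !cmulDr !cmulZl !cmulZr !scalerA -!cmulA.
set X := cstar d ** d; set Y := cstar d ** (k ** d).
set Z := cstar d ** (k ** (k ** d)).
have -> : (s%:C * 'i * t%:C : R[i]) = 'i * t%:C * s%:C by ring.
have -> : ('i * t%:C * 'i * t%:C : R[i]) = ('i ^+ 2) * (t%:C * t%:C) by ring.
rewrite sqrCi mulN1r scaleNr -!rmorphM -!expr2 opprD opprK.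
by rewrite addrA addrK.
Qed.

Lemma rnorm_sa_iadd k d : cstar k = k ->
  ⟦d + 'i *: (k ** d)⟧ ^+ 2 = ⟦cstar d ** (d + k ** (k ** d))⟧.
Proof.
move=> kk; have := @rnorm_sa_complex k d 1 1 kk.
by rewrite expr1n !scale1r cstarM kk cmulDr -!cmulA.
Qed.

Lemma rnorm_sa_isub k d : cstar k = k ->
  ⟦d - 'i *: (k ** d)⟧ = ⟦d + 'i *: (k ** d)⟧.
Proof.
move=> kk; apply/eqP; rewrite -(eqrXn2 (n := 2)) ?rnorm_ge0//.
have := @rnorm_sa_complex k d 1 (-1) kk; have := @rnorm_sa_complex k d 1 1 kk.
by rewrite sqrrN expr1n rmorphN !scale1r scaleNr scale1r scalerN => -> ->.
Qed.

(** The elements [d + 'i k d] and [d - 'i k d] have equal norms, and [d] and ['i k d] are their half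
    sum and half difference. *)
Lemma rnorm_sa_iadd_ge k d : cstar k = k ->
  ⟦d⟧ <= ⟦d + 'i *: (k ** d)⟧ /\ ⟦k ** d⟧ <= ⟦d + 'i *: (k ** d)⟧.
Proof.
move=> kk; set u := d + _; pose v := d - 'i *: (k ** d).
have uv : ⟦v⟧ = ⟦u⟧ by exact: rnorm_sa_isub.
have du : d + d = u + v by rewrite /u /v addrACA subrr addr0.
have ku : 'i *: (k ** d) + 'i *: (k ** d) = u - v.
  by rewrite /u /v opprB addrA addrAC (addrC d) addrK.
have := rnormD u v; have := rnormB u v; rewrite -du -ku !rnormDD rnormZi uv.
by move=> ? ?; split; lra.
Qed.

Lemma le_of_sqr_le_mul (x y : R) : 0 <= x -> 0 <= y -> x ^+ 2 <= x * y -> x <= y.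
Proof. by move=> ? ? ?; nra. Qed.

(** The norm identity bounds [‖d + 'i k d‖^2] by [‖d‖ ‖c‖], and [‖d + 'i k d‖] dominates both [‖d‖]
    and [‖k d‖]. *)
Lemma sa_resolvent_bound k c d : cstar k = k -> d + k ** (k ** d) = c ->
  [/\ ⟦d⟧ <= ⟦c⟧, ⟦k ** d⟧ <= ⟦c⟧ & ⟦k ** (k ** d)⟧ <= ⟦c⟧].
Proof.
move=> kk dc.
have H : ⟦d + 'i *: (k ** d)⟧ ^+ 2 <= ⟦d⟧ * ⟦c⟧.
  by rewrite rnorm_sa_iadd// dc; rewrite -(rnorm_cstar d) rnorm_cmul.
have [d1 d2] := rnorm_sa_iadd_ge d kk.
have := rnorm_ge0 d; have := rnorm_ge0 c; have := rnorm_ge0 (k ** d).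
move: H d1 d2; set x := ⟦d⟧; set y := ⟦k ** d⟧; set z := ⟦c⟧; set w := rnorm _.
move=> H xw yw y0 z0 x0.
have xz : x <= z by apply: le_of_sqr_le_mul => //; nra.
have yz : y <= z by nra.
split=> //; apply: le_of_sqr_le_mul => //; rewrite ?rnorm_ge0//.
(* Here [k d] solves the same equation with right side [k c], and [(k d)^* (k c) = (k^2 d)^* c]. *)
have [_ e] := rnorm_sa_iadd_ge (k ** d) kk.
apply: (@le_trans _ _ (⟦k ** d + 'i *: (k ** (k ** d))⟧ ^+ 2)).
  by rewrite ler_sqr ?nnegrE ?rnorm_ge0.
rewrite rnorm_sa_iadd// -cmulDr dc cstarM kk -cmulA.
have -> : cstar d ** (k ** (k ** c)) = cstar (k ** (k ** d)) ** c.
  by rewrite !cstarM kk -!cmulA.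
by rewrite -(rnorm_cstar (k ** (k ** d))) rnorm_cmul.
Qed.

Lemma sa_resolvent_inj k d : cstar k = k -> d + k ** (k ** d) = 0 -> d = 0.
Proof.
move=> kk /(sa_resolvent_bound kk)[d0 _ _].
by apply: rnorm_le0; rewrite rnorm0 in d0.
Qed.

(** Damped iteration: a fixed point of [d = e c + T d] with [T = 1 - e (1 + 'i k)] solves the
    equation. By the norm identity [‖T d‖^2 <= ((1 - e)^2 + e^2 ‖k‖^2) ‖d‖^2], and the choice of [e]
    turns the factor into [1 - e]. *)
Lemma sa_cayley_solve k c : cstar k = k -> exists d, d + 'i *: (k ** d) = c.
Proof.
move=> kk; set M := ⟦k⟧; pose e : R := (1 + M ^+ 2)^-1.
have M0 : 0 < 1 + M ^+ 2 by rewrite ltr_wpDr ?sqr_ge0.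
have e0 : 0 < e by rewrite invr_gt0.
have e1 : e <= 1 by rewrite invf_le1// lerDl sqr_ge0.
pose T d := (1 - e)%:C *: d + 'i *: ((- e)%:C *: (k ** d)).
have q01 : 0 <= Num.sqrt (1 - e) < 1.
  by rewrite sqrtr_ge0 -[X in _ < X]sqrtr1 ltr_sqrt// ltrBlDr ltrDl.
have [||v vT] := @contraction_solve R B T _ q01 _ _ (e%:C *: c).
- by move=> v w; rewrite /T cmulBr !scalerBr opprD addrACA.
- move=> d; rewrite -(@ler_pXn2r _ 2)// ?nnegrE ?mulr_ge0 ?rnorm_ge0 ?sqrtr_ge0//.
  rewrite rnorm_sa_complex// exprMn sqr_sqrtr ?subr_ge0//.
  apply: (le_trans (rnormD _ _)); rewrite !rnormZr !rnorm_cstar_mul sqrrN.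
  rewrite !ger0_norm ?sqr_ge0//.
  have : ⟦k ** d⟧ ^+ 2 <= (M * ⟦d⟧) ^+ 2.
    by rewrite ler_sqr ?nnegrE ?mulr_ge0 ?rnorm_ge0// rnorm_cmul.
  move=> /(ler_wpM2l (sqr_ge0 e)) /(lerD (lexx _)) /le_trans; apply.
  rewrite exprMn (mulrA (e ^+ 2)) -mulrDl ler_wpM2r ?sqr_ge0//.
  have : e * (e * (1 + M ^+ 2)) = e by rewrite mulVf ?gt_eqF// mulr1.
  by move=> ?; lra.
have E : v - T v = e%:C *: c by apply/eqP; rewrite subr_eq -vT.
exists v; apply: (scalerI (a := e%:C)); first by rewrite fmorph_eq0 gt_eqF.
rewrite -E /T rmorphB rmorph1 scalerBl scale1r opprD addrA subKr.
by rewrite rmorphN scaleNr scalerN opprK scalerDr !scalerA mulrC.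
Qed.

(* [1 - r] is the inverse of [1 + k^2] in the unitization. *)
Definition resolvent_of k r : Prop :=
  [/\ cstar k = k, cstar r = r, r + k ** (k ** r) = k ** k
    & forall z, z ** k = k ** z -> z ** r = r ** z].

(** Since [1 + k^2 = (1 + 'i k) (1 - 'i k)], two applications of [sa_cayley_solve] give [r]. *)
Lemma resolvent_ex k : cstar k = k -> exists r, resolvent_of k r.
Proof.
move=> kk.
have [d1 d1E] := sa_cayley_solve (k ** k) kk.
have [|r] := @sa_cayley_solve (- k) d1; first by rewrite cstarN kk.
rewrite cmulNl scalerN => rE.
have {d1 d1E rE} rE : r + k ** (k ** r) = k ** k.
  rewrite -d1E -rE cmulBr cmulZr scalerBr scalerA -expr2 sqrCi scaleN1r opprK.
  by rewrite addrA subrK.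
(* Comparing the equation for [r] with its adjoint gives [k^2 r = r^* k^2], hence [r^* = r]. *)
have E1 : cstar r + cstar r ** (k ** k) = k ** k.
  by have := congr1 (@cstar _ _) rE; rewrite cstarD !cstarM kk -cmulA.
have E2 : k ** k ** r = cstar r ** (k ** k).
  by rewrite -{1}E1 cmulDl -!cmulA -cmulDr rE.
have rs : cstar r = r.
  by rewrite -[LHS](addrK (cstar r ** (k ** k))) E1 -E2 -{1}rE -cmulA addrK.
exists r; split=> // z zk.
(* The injective map [1 + k^2] sends the commutator [z r - r z] to 0. *)
apply/eqP; rewrite -subr_eq0; apply/eqP/(sa_resolvent_inj kk).
have -> : k ** (k ** (z ** r - r ** z))
    = z ** (k ** (k ** r)) - k ** (k ** r) ** z.
  rewrite !cmulBr; congr (_ - _); last by rewrite -!cmulA.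
  by rewrite (cmulA k z) -zk -cmulA (cmulA k z) -zk -cmulA.
rewrite addrACA -opprD -cmulDr -cmulDl rE.
by rewrite cmulA zk -cmulA zk cmulA subrr.
Qed.

Lemma resolvent_eq k r c : resolvent_of k r ->
  (c - r ** c) + k ** (k ** (c - r ** c)) = c.
Proof.
move=> [_ _ rE _]; rewrite !cmulBr cmulA -rE cmulDl -!cmulA.
by rewrite addrK subrK.
Qed.

Lemma resolvent_bound k r c : resolvent_of k r ->
  [/\ ⟦c - r ** c⟧ <= ⟦c⟧, ⟦k ** (c - r ** c)⟧ <= ⟦c⟧ & ⟦r ** c⟧ <= ⟦c⟧].
Proof.
move=> kr; have cE := resolvent_eq c kr; have [kk _ _ _] := kr.
have [H1 H2] := sa_resolvent_bound kk cE.
suff -> : k ** (k ** (c - r ** c)) = r ** c by [].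
by apply: (addrI (c - r ** c)); rewrite cE subrK.
Qed.

Lemma resolvent_comm k r : resolvent_of k r -> k ** r = r ** k.
Proof. by move=> [_ _ _]; exact. Qed.

Lemma rnorm_resolvent k r : resolvent_of k r -> ⟦r⟧ <= 1.
Proof.
move=> kr; have [_ rs _ _] := kr; have [_ _] := resolvent_bound r kr.
by rewrite rnorm_sq_sa// => ?; have := rnorm_ge0 r; nra.
Qed.

(** The element [w = k (1 + k^2)^-1] satisfies [w^2 = k (1 - r) w], whence [‖w‖^2 <= ‖w‖]. The bound
    does not grow with [k]: for [k = t ⟨x, x⟩] it makes [⟨x, x⟩ - r ⟨x, x⟩] of order [t^-1]. *)
Lemma rnorm_sub_resolvent k r : resolvent_of k r -> ⟦k - r ** k⟧ <= 1.
Proof.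
move=> kr; have [kk rs _ _] := kr; set w := k - r ** k.
have ws : cstar w = w by rewrite cstarB cstarM kk rs (resolvent_comm kr).
have [_ + _] := resolvent_bound w kr.
have -> : k ** (w - r ** w) = w ** w.
  by rewrite {3}/w cmulBl cmulBr cmulA (resolvent_comm kr).
by rewrite rnorm_sq_sa// => ?; have := rnorm_ge0 w; nra.
Qed.

(** The relation [X = Y (1 - r)^m] is squared by moving [1 - r] past [Y]. As [B] need not have a
    unit, [1 - r] is written as the map [c - r ** c] of [c]. *)
Lemma csq_resolvent_step (X Y r : B) m : r ** Y = Y ** r ->
    (forall c, X ** c = Y ** iter m (fun c => c - r ** c) c) ->
  forall c, (X ** X) ** c = (Y ** Y) ** iter (m + m) (fun c => c - r ** c) c.
Proof.
move=> rY XY c.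
have GY n d : iter n (fun c => c - r ** c) (Y ** d)
    = Y ** iter n (fun c => c - r ** c) d.
  by elim: n => // n IH; rewrite !iterS IH cmulBr !cmulA rY.
by rewrite -cmulA !XY GY iterD cmulA.
Qed.

(* For the positive element [w := (1 - r) h (1 - r)] the powers [w^(2^j)] equal
   [h^(2^j) (1 - r)^(2^(j+1))], and [h^(2^j) (1 - r) = s^(2^j) r] is bounded. *)
Lemma rnorm_cutoff (h : B) (s : R) j k r : cstar h = h -> 0 < s ->
    k = csq j (s^-1%:C *: h) -> resolvent_of k r ->
  ⟦(h - r ** h) - (h - r ** h) ** r⟧ <= s.
Proof.
move=> hs s0 kE kr; have [kk rs rE rk] := kr.
have hr : h ** r = r ** h.
  by apply: rk; rewrite kE; apply: csq_comm; rewrite cmulZl cmulZr.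
pose w := (h - r ** h) - (h - r ** h) ** r.
pose G c := c - r ** c.
have ws : cstar w = w.
  rewrite /w !(cstarB, cstarM) hs rs hr cmulBr cmulBl -cmulA hr.
  by rewrite !cmulA.
have wE c : w ** c = h ** iter 2 G c.
  rewrite /w /G /= !cmulBl !cmulBr -!cmulA (cmulA h r) hr -!cmulA.
  by rewrite (cmulA h r (r ** c)) hr -cmulA (cmulA h r c) hr -!cmulA.
have wn n c : csq n w ** c = csq n h ** iter (2 ^ n.+1) G c.
  elim: n c => [|n IH] c; first by rewrite wE.
  rewrite !csqS (csq_resolvent_step (Y := csq n h) _ IH) ?csq_comm//.
  by rewrite addnn -mul2n -expnS.
have G1 n c : ⟦iter n G c⟧ <= ⟦c⟧.
  elim: n => // n IH; apply: le_trans IH.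
  by have [] := resolvent_bound (iter n G c) kr.
(* The resolvent inverts [1 + k^2] and not [1 + k], so the exponent that meets it is that of
   [j.+1]. *)
have kE2 : csq j.+1 h = (s ^+ (2 ^ j.+1))%:C *: (k ** k).
  rewrite kE -csqS csqZ scalerA -rmorphM /= -exprMn divff ?gt_eqF//.
  by rewrite expr1n scale1r.
have wb c : ⟦csq j.+1 w ** c⟧ <= s ^+ (2 ^ j.+1) * ⟦c⟧.
  rewrite wn kE2 cmulZl rnormZr (ger0_norm (exprn_ge0 _ (ltW s0))).
  apply: ler_wpM2l; first by rewrite exprn_ge0// ltW.
  (* One factor [1 - r] is absorbed by [k^2 (1 - r) = r]; the others are contractive. *)
  have /prednK <- : (0 < 2 ^ j.+2)%N by rewrite expn_gt0.
  rewrite iterS -cmulA; apply: le_trans (G1 (2 ^ j.+2).-1 c).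
  have [_ _] :=
    sa_resolvent_bound kk (resolvent_eq (iter (2 ^ j.+2).-1 G c) kr).
  by [].
(* Inserting [w^(2^(j+1))] itself gives [W^2 <= S W]; the root of order [2^(j+1)] is then taken in
   [W <= S]. *)
have := wb (csq j.+1 w); rewrite rnorm_sq_sa ?csq_sa// rnorm_csq//.
set S := s ^+ _; set W := ⟦w⟧ ^+ _ => WS.
have W0 : 0 <= W by rewrite exprn_ge0 ?rnorm_ge0.
have S0 : 0 <= S by rewrite exprn_ge0 ?ltW.
have : W <= S by nra.
by rewrite ler_pXn2r// ?nnegrE ?rnorm_ge0 ?ltW// expn_gt0.
Qed.
End CStarAlgebra.

(** * Hilbert modules and the Cauchy-Schwarz inequality *)

Section HilbertModule.
Variables (R : realType) (B : cstarAlgType R) (E : hilbertModType B).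
Implicit Types (x y z : E) (b c d : B).

Lemma ract0l b : (0 : E) |> b = 0.
Proof. by apply: (addrI ((0 : E) |> b)); rewrite -ractDl !addr0. Qed.

Lemma ract0r x : x |> 0 = 0.
Proof. by apply: (addrI (x |> 0)); rewrite -ractDr !addr0. Qed.

Lemma ractNl x b : (- x) |> b = - (x |> b).
Proof. by apply: (addrI (x |> b)); rewrite -ractDl !subrr ract0l. Qed.

Lemma ractNr x b : x |> (- b) = - (x |> b).
Proof. by apply: (addrI (x |> b)); rewrite -ractDr !subrr ract0r. Qed.

Lemma ractBl x y b : (x - y) |> b = x |> b - y |> b.
Proof. by rewrite ractDl ractNl. Qed.

Lemma ractBr x b c : x |> (b - c) = x |> b - x |> c.
Proof. by rewrite ractDr ractNr. Qed.

Lemma innerDl x y z : ⟨x + y, z⟩ = ⟨x, z⟩ + ⟨y, z⟩.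
Proof. by rewrite -inner_star innerDr cstarD !inner_star. Qed.

Lemma inner0r x : ⟨x, 0⟩ = 0.
Proof. by apply: (addrI ⟨x, 0⟩); rewrite -innerDr !addr0. Qed.

Lemma inner0l x : ⟨0, x⟩ = 0.
Proof. by rewrite -inner_star inner0r cstar0. Qed.

Lemma innerNr x y : ⟨x, - y⟩ = - ⟨x, y⟩.
Proof. by apply: (addrI ⟨x, y⟩); rewrite -innerDr !subrr inner0r. Qed.

Lemma innerNl x y : ⟨- x, y⟩ = - ⟨x, y⟩.
Proof. by rewrite -inner_star innerNr cstarN inner_star. Qed.

Lemma innerBr x y z : ⟨x, y - z⟩ = ⟨x, y⟩ - ⟨x, z⟩.
Proof. by rewrite innerDr innerNr. Qed.

Lemma innerBl x y z : ⟨x - y, z⟩ = ⟨x, z⟩ - ⟨y, z⟩.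
Proof. by rewrite innerDl innerNl. Qed.

Lemma innerZl (k : R[i]) x y : ⟨k *: x, y⟩ = Num.conj k *: ⟨x, y⟩.
Proof. by rewrite -inner_star innerZr cstarZ inner_star. Qed.

Lemma inner_ractl x y b : ⟨x |> b, y⟩ = cstar b ** ⟨x, y⟩.
Proof. by rewrite -inner_star inner_ract cstarM inner_star. Qed.

Lemma inner_sa x : cstar ⟨x, x⟩ = ⟨x, x⟩.
Proof. exact: inner_star. Qed.

Lemma rnorm_inner x : ⟦⟨x, x⟩⟧ = ⟦x⟧ ^+ 2.
Proof. by apply/complexI; rewrite -rnormE -inner_norm rnormE rmorphXn. Qed.

Lemma rnorm_ract x b : ⟦x |> b⟧ <= ⟦x⟧ * ⟦b⟧.
Proof.
rewrite -(@ler_pXn2r _ 2)// ?nnegrE ?mulr_ge0 ?rnorm_ge0//.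
rewrite -rnorm_inner inner_ract inner_ractl exprMn -rnorm_inner expr2.
apply: (le_trans (rnorm_cmul _ _)); rewrite mulrA ler_wpM2r ?rnorm_ge0//.
by apply: (le_trans (rnorm_cmul _ _)); rewrite rnorm_cstar mulrC.
Qed.

(* With [⟨x, x⟩ = k^* k] this is [‖k^* (k b)‖ <= ‖k‖ ‖k b‖]. *)
Lemma rnorm_inner_ract x b : ⟦⟨x, x⟩ ** b⟧ <= ⟦x⟧ * ⟦x |> b⟧.
Proof.
have [k kE] := inner_ge0 x.
have nE c : ⟦x |> c⟧ = ⟦k ** c⟧.
  apply/eqP; rewrite -(eqrXn2 (n := 2)) ?rnorm_ge0// -rnorm_inner.
  rewrite inner_ract inner_ractl kE -rnorm_cstar_mul cstarM.
  by rewrite -!cmulA.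
have xk : ⟦x⟧ = ⟦k⟧.
  apply/eqP; rewrite -(eqrXn2 (n := 2)) ?rnorm_ge0// -rnorm_inner kE.
  by rewrite rnorm_cstar_mul.
by rewrite nE xk kE -cmulA -(rnorm_cstar k) rnorm_cmul.
Qed.

(** The right side is [(1 - b) ⟨x, x⟩ (1 - b)] written without a unit, the form bounded by
    [rnorm_cutoff]. *)
Lemma rnorm_sub_ract x b : cstar b = b ->
  ⟦x - x |> b⟧ ^+ 2 = ⟦(⟨x, x⟩ - b ** ⟨x, x⟩) - (⟨x, x⟩ - b ** ⟨x, x⟩) ** b⟧.
Proof.
move=> bs; rewrite -rnorm_inner innerBr inner_ract innerBl inner_ractl bs.
by rewrite cmulBl.
Qed.

Lemma rnorm_sub_ract_resolvent x k r : resolvent_of k r ->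
  ⟦x - x |> r⟧ ^+ 2 <= ⟦⟨x, x⟩ - r ** ⟨x, x⟩⟧ /\ ⟦x - x |> r⟧ <= ⟦x⟧.
Proof.
move=> kr; have [_ rs _ _] := kr; set w := ⟨x, x⟩ - r ** ⟨x, x⟩.
have H : ⟦x - x |> r⟧ ^+ 2 <= ⟦w⟧.
  rewrite rnorm_sub_ract// -/w -rnorm_cstar cstarB cstarM rs -(rnorm_cstar w).
  by have [] := resolvent_bound (cstar w) kr.
split=> //; rewrite -(@ler_pXn2r _ 2)// ?nnegrE ?rnorm_ge0//.
apply: (le_trans H); rewrite -rnorm_inner.
by have [] := resolvent_bound ⟨x, x⟩ kr.
Qed.

Lemma rnorm_sub_ract_small x (t : R) r : 0 < t ->
  resolvent_of (t%:C *: ⟨x, x⟩) r -> ⟦x - x |> r⟧ ^+ 2 <= t^-1.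
Proof.
move=> t0 kr; have [H _] := rnorm_sub_ract_resolvent x kr; apply: (le_trans H).
have := rnorm_sub_resolvent kr.
rewrite cmulZr -scalerBr rnormZr gtr0_norm// => H'.
by rewrite -(ler_pM2l t0) divff ?gt_eqF.
Qed.

(* With [T := (1 - i t θ) (1 + i t θ)^-1] the Cayley transform of the rank one
   operator [θ := x⟨x, .⟩], one has [y - T y = 2 i t x d] and [‖T y‖ = ‖y‖]. *)
Lemma rnorm_cayley x y (t : R) d : 0 < t ->
    d + 'i *: ((t%:C *: ⟨x, x⟩) ** d) = ⟨x, y⟩ ->
  t * ⟦x |> d⟧ <= ⟦y⟧.
Proof.
move=> t0 dE; pose u := t%:C *: (x |> d).
pose Ty := y - ('i *: u + 'i *: u).
have : ⟦Ty⟧ = ⟦y⟧.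
  apply/eqP; rewrite -(eqrXn2 (n := 2)) ?rnorm_ge0// -!rnorm_inner.
  apply/eqP; congr rnorm.
  rewrite /Ty; set v := 'i *: u.
  rewrite innerBr !innerBl !innerDr !innerDl.
  set q := ⟨x, y⟩ in dE.
  have uy : ⟨v, y⟩ = - (('i * t%:C) *: (cstar d ** q)).
    by rewrite /v /u !innerZl conjCi conjr inner_ractl scalerA mulNr scaleNr.
  have yu : ⟨y, v⟩ = ('i * t%:C) *: (cstar q ** d).
    by rewrite /v /u !innerZr inner_ract /q inner_star scalerA.
  have uu : ⟨v, v⟩ = (t%:C * t%:C) *: (cstar d ** (⟨x, x⟩ ** d)).
    rewrite /v /u !innerZl !innerZr inner_ract inner_ractl !scalerA.
    rewrite conjCi conjr.
    by rewrite !mulNr mulrACA -expr2 sqrCi mulN1r opprK -cmulA.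
  set X := cstar d ** (⟨x, x⟩ ** d) in uu.
  have dq : cstar d ** q = cstar d ** d + ('i * t%:C) *: X.
    by rewrite -dE cmulDr cmulZr cmulZl cmulZr scalerA.
  have qd : cstar q ** d = cstar d ** d - ('i * t%:C) *: X.
    rewrite -dE cstarD cstarZ conjCi cmulZl cstarZr cstarM inner_sa.
    by rewrite cmulDl cmulZl !cmulZl -!cmulA scaleNr scalerA.
  (* For [T y = y - 2 v] the equality [⟨T y, T y⟩ = ⟨y, y⟩] amounts to this identity. *)
  have vyv : ⟨v, y⟩ + ⟨y, v⟩ = ⟨v, v⟩ + ⟨v, v⟩.
    rewrite uy yu uu dq qd scalerBr scalerDr opprD addrACA addNr add0r.
    have -> : 'i * t%:C *: ('i * t%:C *: X) = - ((t%:C * t%:C) *: X).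
      rewrite scalerA -scaleNr; congr (_ *: _).
      by rewrite mulrACA -expr2 sqrCi mulN1r.
    by rewrite opprK.
  have -> : ⟨y, v⟩ = ⟨v, v⟩ + ⟨v, v⟩ - ⟨v, y⟩.
    by rewrite -vyv addrAC subrr add0r.
  set w := ⟨v, v⟩; set p := ⟨v, y⟩.
  have -> : (w + w - p) + (w + w - p) = (w + w + (w + w)) - (p + p).
    by rewrite addrACA opprD.
  by rewrite (addrAC (w + w + _)) subrr add0r opprK subrK.
move=> TyE; have : ⟦y - Ty⟧ <= 2 * ⟦y⟧.
  by apply: (le_trans (rnormB _ _)); rewrite TyE; lra.
rewrite /Ty opprB addrC subrK rnormDD rnormZi rnormZr gtr0_norm//.
by rewrite ler_pM2l.
Qed.

(** For [u = x d], the terms with ['i t] cancel in [⟨u, y⟩ + ⟨y, u⟩] and [2 d^* d] remains;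
    polarization then bounds [‖d‖^2] by norms of vectors in [E]. *)
Lemma rnorm_cayley_small x y (t : R) d : 0 < t ->
    d + 'i *: ((t%:C *: ⟨x, x⟩) ** d) = ⟨x, y⟩ ->
  ⟦d⟧ ^+ 2 <= 2 * ⟦y⟧ ^+ 2 / t.
Proof.
move=> t0 dE; have tu := rnorm_cayley t0 dE; set u := x |> d in tu.
have s0 : 0 < Num.sqrt t by rewrite sqrtr_gt0.
set s := Num.sqrt t in s0; have st : s ^+ 2 = t by rewrite sqr_sqrtr// ltW.
(* Rescaling keeps the mixed inner products and gives both vectors norm at most [‖y‖ / sqrt t]. *)
pose a := s%:C *: u; pose b := s^-1%:C *: y.
have ss : (s%:C * s^-1%:C : R[i]) = 1 by rewrite -rmorphM /= divff ?gt_eqF.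
have uyE : ⟨u, y⟩ + ⟨y, u⟩ = cstar d ** d + cstar d ** d.
  rewrite /u inner_ractl inner_ract -(inner_star x y) -dE.
  rewrite cmulDr cstarD cmulDl cmulZr cstarZ conjCi cmulZl scaleNr.
  rewrite cstarZr cstarM inner_sa cmulNl !cmulZl cmulZr -cmulA.
  by rewrite addrACA subrr addr0.
have ab : ⟨a, b⟩ + ⟨b, a⟩ = cstar d ** d + cstar d ** d.
  rewrite /a /b !innerZl !innerZr !conjr !scalerA (mulrC s^-1%:C) ss !scale1r.
  exact: uyE.
have : ⟨a + b, a + b⟩ - ⟨a - b, a - b⟩
    = (cstar d ** d + cstar d ** d) + (cstar d ** d + cstar d ** d).
  rewrite -ab innerBr !innerBl !innerDr !innerDl !opprB.
  set p := ⟨a, a⟩; set q := ⟨a, b⟩; set q' := ⟨b, a⟩; set w := ⟨b, b⟩.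
  transitivity (q' + q' + (q + q)); last by rewrite addrACA (addrC q').
  rewrite (addrC (q - w)) [LHS]addrACA; congr (_ + _).
    by rewrite (addrC p) addrACA subrr addr0.
  by rewrite addrACA subrr addr0.
move=> abE.
have : 4 * ⟦d⟧ ^+ 2 <= ⟦a + b⟧ ^+ 2 + ⟦a - b⟧ ^+ 2.
  rewrite -!rnorm_inner -rnorm_cstar_mul.
  have -> : 4 * ⟦cstar d ** d⟧ = 2 * (2 * ⟦cstar d ** d⟧) :> R by ring.
  by rewrite -!rnormDD -abE rnormB.
have := rnormD a b; have := rnormB a b; have := rnorm_ge0 (a + b).
have := rnorm_ge0 (a - b); rewrite ler_pdivlMr//.
have aE : ⟦a⟧ = s * ⟦u⟧ by rewrite rnormZr gtr0_norm.
have bE : s * ⟦b⟧ = ⟦y⟧.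
  by rewrite rnormZr gtr0_norm ?invr_gt0// mulrA divff ?gt_eqF// mul1r.
have : s * ⟦a⟧ <= ⟦y⟧ by rewrite aE mulrA -expr2 st.
rewrite -bE ler_pM2l// => ab'; rewrite exprMn st => P1 P2 P3 P4 P5.
have : ⟦a + b⟧ ^+ 2 <= (2 * ⟦b⟧) ^+ 2 by rewrite ler_sqr ?nnegrE; lra.
have : ⟦a - b⟧ ^+ 2 <= (2 * ⟦b⟧) ^+ 2 by rewrite ler_sqr ?nnegrE; lra.
move=> Q1 Q2; rewrite (mulrC t) mulrA ler_pM2r//; lra.
Qed.

(* As [t] grows, [‖⟨x, y⟩ - d‖ = t ‖⟨x, x⟩ d‖ <= ‖x‖ ‖y‖] and [d] tends to [0].
   Only the triangle inequality in [E] and [⟨x, x⟩ = k^* k] are used, not the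
   positivity of sums of elements [k^* k]. *)
Lemma rnorm_inner_le x y : ⟦⟨x, y⟩⟧ <= ⟦x⟧ * ⟦y⟧.
Proof.
rewrite leNgt; apply/negP => lt_q.
pose e := ⟦⟨x, y⟩⟧ - ⟦x⟧ * ⟦y⟧; have e0 : 0 < e by rewrite subr_gt0.
(* This makes [2 ‖y‖^2 / t] strictly smaller than [e^2], and [t] positive even for [y = 0]. *)
pose t := (2 * ⟦y⟧ ^+ 2 + 1) / e ^+ 2.
have t0 : 0 < t by rewrite divr_gt0 ?exprn_gt0// ltr_wpDl// mulr_ge0 ?sqr_ge0.
have [|d dE] := @sa_cayley_solve _ _ (t%:C *: ⟨x, x⟩) ⟨x, y⟩.
  by rewrite cstarZr inner_sa.
have ed : e <= ⟦d⟧.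
  rewrite lerBlDr -dE; apply: (le_trans (rnormD _ _)); rewrite lerD2l rnormZi.
  rewrite cmulZl rnormZr gtr0_norm//.
  apply: (le_trans (ler_wpM2l (ltW t0) (rnorm_inner_ract _ _))).
  by rewrite mulrCA ler_wpM2l ?rnorm_ge0// rnorm_cayley.
have : e ^+ 2 <= 2 * ⟦y⟧ ^+ 2 / t.
  apply: le_trans (rnorm_cayley_small t0 dE).
  by rewrite ler_sqr ?nnegrE ?rnorm_ge0// ltW.
rewrite ler_pdivlMr// /t mulrC divfK ?gt_eqF ?exprn_gt0//.
by rewrite gerDl ler10.
Qed.
End HilbertModule.

(** * Cohen factorization *)

Section Factorization.
Variables (R : realType) (B : cstarAlgType R) (E : hilbertModType B).
Implicit Types (x y z v : E) (b r : B).

Section Averages.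
Variable r : nat -> B.
Hypothesis rC : forall i j, r i ** r j = r j ** r i.
Hypothesis r1 : forall j v, ⟦v - v |> r j⟧ <= ⟦v⟧.

Let w j : R := 2^-1 ^+ j.+1.
Let G j v : E := v - v |> r j.

(** The map [1 - davg N] is Cohen's multiplier [2^-N + ravg N] in the unitization; as 1 minus a
    strict contraction it is invertible on [E]. *)
Definition davg N v : E := \sum_(j < N) (w j)%:C *: G j v.
Definition ravg N : B := \sum_(j < N) (w j)%:C *: r j.

Let w0 n : 0 <= 2^-1 ^+ n :> R.
Proof. by rewrite exprn_ge0. Qed.

Let GB j v u : G j (v - u) = G j v - G j u.
Proof. by rewrite /G ractBl opprD addrACA [in RHS]opprD opprK. Qed.

Let GD j (k : R[i]) v u : G j (v + k *: u) = G j v + k *: G j u.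
Proof. by rewrite /G ractDl ractZl scalerBr opprD addrACA. Qed.

Lemma davgS N v : davg N.+1 v = davg N v + (w N)%:C *: G N v.
Proof. by rewrite /davg big_ord_recr. Qed.

Lemma ravgS N : ravg N.+1 = ravg N + (w N)%:C *: r N.
Proof. by rewrite /ravg big_ord_recr. Qed.

Lemma davgB N v u : davg N (v - u) = davg N v - davg N u.
Proof.
elim: N => [|N IH]; first by rewrite /davg !big_ord0 subr0.
by rewrite !davgS IH GB scalerBr opprD addrACA.
Qed.

Lemma davg_G N m v : davg N (G m v) = G m (davg N v).
Proof.
elim: N => [|N IH].
  by rewrite /davg !big_ord0 /G ract0l subr0.
rewrite !davgS IH.
have -> : G N (G m v) = G m (G N v).
  rewrite /G !ractBl !ractA (rC m) !opprB -!addrA; congr (_ + _).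
  by rewrite addrCA [RHS]addrCA; congr (_ + _); exact: addrC.
by rewrite GD.
Qed.

Lemma rnorm_davg N v : ⟦davg N v⟧ <= (1 - 2^-1 ^+ N) * ⟦v⟧.
Proof.
elim: N => [|N IH]; first by rewrite /davg big_ord0 rnorm0 subrr mul0r.
rewrite davgS; apply: (le_trans (rnormD _ _)).
apply: (le_trans (lerD IH (lexx _))).
have : ⟦(w N)%:C *: G N v⟧ <= w N * ⟦v⟧.
  by rewrite rnormZr ger0_norm ?w0//; apply: ler_wpM2l; [exact: w0|exact: r1].
by rewrite /w !exprS => ?; lra.
Qed.

(** The weights sum to [1 - 2^-N], so [davg N] loses the fraction [2^-N] of the norm; this bounds
    the inverse of Cohen's multiplier by [2^N]. *)
Lemma rnorm_sub_davg N v : ⟦v⟧ <= 2 ^+ N * ⟦v - davg N v⟧.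
Proof.
have N0 : 0 < 2 ^+ N :> R by rewrite exprn_gt0.
have := rnorm_dist v (davg N v); have := rnorm_davg N v.
rewrite -(ler_pdivrMl _ _ N0) -exprVn => P1 P2; lra.
Qed.

Lemma davgE N v : v - davg N v = (2^-1 ^+ N)%:C *: v + v |> ravg N.
Proof.
elim: N => [|N IH].
  by rewrite /davg /ravg !big_ord0 subr0 ract0r scale1r addr0.
rewrite davgS ravgS opprD addrA IH ractDr ractZr /G scalerBr opprB.
have -> : (2^-1 ^+ N)%:C = (2^-1 ^+ N.+1)%:C + (w N)%:C :> R[i].
  by rewrite -rmorphD /= /w !exprS; congr (_%:C); lra.
rewrite scalerDl; set a := _ *: v; set e := v |> ravg N.
by rewrite (addrAC a) -(addrA (a + e)) (addrCA a) subrr addr0 addrA.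
Qed.
End Averages.

Lemma rnorm_expr_half (n : nat) : 0 <= 2^-1 ^+ n :> R.
Proof. by rewrite exprn_ge0. Qed.

(* Cohen's factorization with the approximate unit
   [r_j = t_j^2 h^2 (1 + t_j^2 h^2)^-1], [h = ⟨x, x⟩]. *)
Theorem hilbert_factorization x : exists y b, x = y |> b.
Proof.
(* Since [‖x - x r_j‖^2 <= 1 / t_j], the base 16 yields the bound [4^-(j+1)], which beats the growth
   [2^N] of the inverse multipliers. *)
pose h := ⟨x, x⟩; pose t j : R := 16 ^+ j.+1.
have t0 j : 0 < t j by rewrite exprn_gt0.
have /choice[r rP] : forall j, exists r, resolvent_of ((t j)%:C *: h) r.
  by move=> j; apply: resolvent_ex; rewrite cstarZr inner_sa.
have hr j : h ** r j = r j ** h.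
  by have [_ _ _] := rP j; apply; rewrite cmulZl cmulZr.
have rC i j : r i ** r j = r j ** r i.
  by have [_ _ _] := rP j; apply; rewrite cmulZl cmulZr hr.
have r1 j v : ⟦v - v |> r j⟧ <= ⟦v⟧.
  by have [] := rnorm_sub_ract_resolvent v (rP j).
have xr j : ⟦x - x |> r j⟧ <= 4^-1 ^+ j.+1.
  rewrite -(@ler_pXn2r _ 2)// ?nnegrE ?rnorm_ge0 ?exprn_ge0//.
  apply: (le_trans (rnorm_sub_ract_small (t0 j) (rP j))).
  suff -> : (t j)^-1 = 4^-1 ^+ j.+1 ^+ 2 by [].
  by rewrite exprAC /t -exprVn; congr (_ ^+ _); field.
have /choice[y yE] : forall N, exists y, y = x + davg r N y.
  move=> N; apply: (@contraction_solve _ E _ (1 - 2^-1 ^+ N)).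
  - rewrite subr_ge0 ltrBlDr ltrDl exprn_gt0 ?invr_gt0// andbT.
    by rewrite exprn_ile1// invf_le1// ler1n.
  - exact: davgB.
  - by move=> v; exact: rnorm_davg.
have xE N : y N - davg r N (y N) = x by rewrite {1}yE addrK.
(* Both [y N] and [y N.+1] come from the same [x], so [1 - davg N.+1] sends [d] to [2^-(N+1) g]; as
   the [r_j] commute, [1 - davg N] sends [g] to [x - x r_N]. *)
have dy N : ⟦y N.+1 - y N⟧ <= 4^-1 * 2^-1 ^+ N.
  set d := y N.+1 - y N; pose g := y N - y N |> r N.
  have dE : d - davg r N.+1 d = (2^-1 ^+ N.+1)%:C *: g.
    have yS : y N - davg r N.+1 (y N) = x - (2^-1 ^+ N.+1)%:C *: g.
      by rewrite davgS opprD addrA xE.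
    by rewrite davgB opprD addrACA xE -opprD yS subKr.
  have gE : ⟦g⟧ <= 2 ^+ N * 4^-1 ^+ N.+1.
    apply: (le_trans (rnorm_sub_davg r1 N g)).
    rewrite ler_wpM2l ?exprn_ge0// davg_G// opprD addrACA -opprD -ractBl xE.
    exact: xr.
  apply: (le_trans (rnorm_sub_davg r1 N.+1 d)); rewrite dE rnormZr.
  rewrite ger0_norm ?rnorm_expr_half// mulrA -exprMn divff// expr1n mul1r.
  apply: (le_trans gE); rewrite exprS mulrCA -exprMn.
  by have -> : 2 / 4 = 2^-1 :> R by field.
have db N : ⟦ravg r N.+1 - ravg r N⟧ <= 2^-1 * 2^-1 ^+ N.
  rewrite ravgS addrC addKr rnormZr ger0_norm ?rnorm_expr_half//.
  rewrite -exprS -[leRHS]mulr1; apply: ler_wpM2l; first exact: rnorm_expr_half.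
  exact: rnorm_resolvent (rP N).
have q01 : 0 <= (2^-1 : R) < 1 by apply/andP; split; lra.
have [l yl] := geometric_cvg q01 dy.
have [b bl] := geometric_cvg q01 db.
exists l, b; apply/eqP; rewrite -subr_eq0; apply/eqP/rnorm_le0.
have q0 : (2^-1 ^+ n @[n --> \oo] --> (0 : R)).
  by apply: cvg_expr; rewrite ger0_norm//; lra.
(* This majorizes [‖x - l b‖], through [x = 2^-n y_n + y_n (ravg n)]. *)
pose f n := 2^-1 ^+ n * (⟦y n - l⟧ + ⟦l⟧) + ⟦y n - l⟧ * (⟦ravg r n - b⟧ + ⟦b⟧)
  + ⟦l⟧ * ⟦ravg r n - b⟧.
apply: (@rnorm_cvg_le0 _ f).
  rewrite (_ : 0 = 0 * (0 + ⟦l⟧) + 0 * (0 + ⟦b⟧) + ⟦l⟧ * 0); last by ring.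
  apply: cvgD; first apply: cvgD.
  - by apply: cvgM => //; apply: cvgD => //; exact: cvg_cst.
  - by apply: cvgM => //; apply: cvgD => //; exact: cvg_cst.
  - by apply: cvgM => //; exact: cvg_cst.
move=> n; rewrite -(xE n) davgE -addrA /f -addrA.
apply: (le_trans (rnormD _ _)); apply: lerD.
  rewrite rnormZr ger0_norm ?rnorm_expr_half// ler_wpM2l ?rnorm_expr_half//.
  exact: rnorm_dist.
have -> : y n |> ravg r n - l |> b
    = (y n - l) |> ravg r n + l |> (ravg r n - b).
  by rewrite ractBl ractBr addrA subrK.
apply: (le_trans (rnormD _ _)); apply: lerD; last exact: rnorm_ract.
apply: (le_trans (rnorm_ract _ _)); rewrite ler_wpM2l ?rnorm_ge0//.
exact: rnorm_dist.
Qed.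
End Factorization.

(** * Bounded linear maps *)

Section LinearMaps.
Variable R : realType.

Lemma linear_pack (V W : lmodType R[i]) (f : V -> W) :
  linear f -> exists g : {linear V -> W}, g =1 f.
Proof.
move=> lf.
pose g : {linear V -> W} := HB.pack f (GRing.isLinear.Build _ _ _ _ f lf).
by exists g.
Qed.

Lemma le0_eps (x C : R) : 0 <= C -> (forall e, 0 < e -> x <= C * e) -> x <= 0.
Proof.
move=> C0 xC; rewrite leNgt; apply/negP => x0.
have d0 : 0 < 2 * (C + 1) by lra.
have := xC _ (divr_gt0 x0 d0); rewrite mulrA ler_pdivlMr//; nra.
Qed.

Lemma dense_rnorm (V : normedModType R[i]) (S : set V) (z : V) (e : R) :
  dense S -> 0 < e -> exists2 v, S v & ⟦v - z⟧ < e.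
Proof.
move=> dS e0; have e0C : 0 < (e%:C : R[i]) by rewrite ltcR.
have [|v [zv Sv]] := dS (ball z (e%:C : R[i]))^° _ (open_interior _).
  by exists z; exact: (nbhsx_ballx z _ e0C).
exists v => //; move: (interior_subset zv).
by rewrite -ball_normE /= rnormE ltcR rnormBC.
Qed.

Lemma dense_eq (H F : normedModType R[i]) (S : set H) (P Q : H -> F) (C : R) :
    dense S -> (forall z w, ⟦P z - P w⟧ <= C * ⟦z - w⟧) ->
    (forall z w, ⟦Q z - Q w⟧ <= C * ⟦z - w⟧) -> (forall z, S z -> P z = Q z) ->
  P =1 Q.
Proof.
move=> dS PC QC PQ z; apply/eqP; rewrite -subr_eq0; apply/eqP/rnorm_le0.
apply: (@le0_eps _ (`|C| + `|C|)) => [|e e0]; first by rewrite addr_ge0.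
have [v Sv vz] := dense_rnorm z dS e0.
rewrite -(subrK (P v) (P z)) -addrA {2}(PQ v Sv).
apply: (le_trans (rnormD _ _)); rewrite mulrDl.
have b : C * ⟦v - z⟧ <= `|C| * e.
  apply: (@le_trans _ _ (`|C| * ⟦v - z⟧)).
    by rewrite ler_wpM2r ?rnorm_ge0// ler_norm.
  by rewrite ler_wpM2l// ltW.
by apply: lerD; apply: le_trans b; [rewrite rnormBC; exact: PC|exact: QC].
Qed.

(** The relation [rel] is the closure of the graph of [iota v ↦ f v]. The bound survives the closure
    and makes it single-valued; density and the completeness of [F] make it total. *)
Lemma dense_extend (V : lmodType R[i]) (H : normedModType R[i])
    (F : completeNormedModType R[i]) (iota : {linear V -> H})
    (f : {linear V -> F}) (M : R) :
    0 <= M -> dense (range iota) -> (forall v, ⟦f v⟧ <= M * ⟦iota v⟧) ->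
  exists A : {linear H -> F},
    (forall v, A (iota v) = f v) /\ (forall z, ⟦A z⟧ <= M * ⟦z⟧).
Proof.
move=> M0 di fM.
pose rel z y := forall e, 0 < e -> exists v, ⟦iota v - z⟧ < e /\ ⟦f v - y⟧ < e.
have rel_bound z y : rel z y -> ⟦y⟧ <= M * ⟦z⟧.
  move=> zy; rewrite -subr_le0; apply: (@le0_eps _ (M + 1)) => [|e e0].
    lra.
  have [v [vz vy]] := zy _ e0.
  have := fM v; have := rnorm_dist (iota v) z; have := rnorm_dist y (f v).
  rewrite (rnormBC y) => P1 P2 P3; nra.
have rel_ex z : exists y, rel z y.
  have q0 n : 0 < 2^-1 ^+ n :> R by rewrite exprn_gt0.
  have /choice[v vz] : forall n, exists v, ⟦iota v - z⟧ < 2^-1 ^+ n.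
    by move=> n; have [_ [v _ <-] ?] := dense_rnorm z di (q0 n); exists v.
  have q01 : 0 <= (2^-1 : R) < 1 by apply/andP; split; lra.
  have [n|l fl] := @geometric_cvg R F (f \o v) (2 * M) _ q01.
    rewrite /= -raddfB; apply: (le_trans (fM _)); rewrite raddfB -mulrA mulrCA.
    rewrite ler_wpM2l//.
    have -> : iota (v n.+1) - iota (v n)
        = (iota (v n.+1) - z) - (iota (v n) - z).
      by rewrite opprB addrA subrK.
    have := vz n; have := vz n.+1; rewrite exprS => P1 P2.
    have := q0 n; have := rnormB (iota (v n.+1) - z) (iota (v n) - z).
    by move=> *; lra.
  exists l => e e0.
  have q_lim : (2^-1 ^+ n @[n --> \oo] --> (0 : R)).
    by apply: cvg_expr; rewrite ger0_norm//; lra.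
  move/cvgrPdist_lt/(_ e e0) : q_lim => [N1 _ qN].
  move/cvgrPdist_lt/(_ e e0) : fl => [N2 _ fN].
  exists (v (maxn N1 N2)); split.
    have := qN _ (leq_maxl N1 N2); rewrite /= sub0r normrN ger0_norm ?ltW//.
    by apply: lt_trans.
  have := fN _ (leq_maxr N1 N2).
  by rewrite /= sub0r normrN ger0_norm ?rnorm_ge0.
have rel_lin (k : R[i]) z y z' y' :
    rel z y -> rel z' y' -> rel (k *: z + z') (k *: y + y').
  move=> zy zy' e e0; set K := complex.Re `|k|.
  have K0 : 0 <= K by rewrite /K normc_def sqrtr_ge0.
  have e1 : 0 < e / (K + 1) by rewrite divr_gt0// ltr_wpDl.
  have eE : K * (e / (K + 1)) + e / (K + 1) = e by field; lra.
  have [v [vz vy]] := zy _ e1; have [v' [vz' vy']] := zy' _ e1.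
  exists (k *: v + v'); rewrite !linearP.
  by split; rewrite addrACA -scalerDr; apply: (le_lt_trans (rnormD _ _));
    rewrite rnormZ -/K; nra.
have /choice[A A_rel] := rel_ex.
have rel_uniq z y : rel z y -> A z = y.
  move=> zy; apply/eqP; rewrite -subr_eq0; apply/eqP/rnorm_le0.
  have := rel_bound _ _ (rel_lin (-1) _ _ _ _ zy (A_rel z)).
  by rewrite !scaleN1r addNr rnorm0 mulr0 addrC.
have linA : linear A by move=> k z w; apply/rel_uniq/rel_lin.
have [A' A'E] := linear_pack linA; exists A'; split=> [v|z]; rewrite A'E.
  by apply: rel_uniq => e e0; exists v; rewrite !subrr !rnorm0.
exact: rel_bound.
Qed.

Lemma bounded_map_rnorm (V W : normedModType R[i]) (f : V -> W) (M : R) :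
  (forall v, ⟦f v⟧ <= M * ⟦v⟧) -> bounded_map f.
Proof. by move=> fM; exists M%:C => v; rewrite !rnormE -rmorphM lecR. Qed.

Lemma bounded_map_ex (V W : normedModType R[i]) (f : V -> W) :
  bounded_map f -> exists2 M : R, 0 <= M & forall v, ⟦f v⟧ <= M * ⟦v⟧.
Proof.
(* The given constant lies in [R[i]]; its real part [m1] can be negative if [V] is zero, hence the
   absolute value. *)
move=> [[m1 m2] fM]; exists `|m1| => // v; have := fM v.
rewrite !rnormE lecE /= !mulr0 subr0 => /andP[_ /le_trans]; apply.
by rewrite ler_wpM2r ?rnorm_ge0// ler_norm.
Qed.

Lemma opnorm_le (V W : normedModType R[i]) (f : V -> W) (M : R) :
  0 <= M -> (forall v, ⟦f v⟧ <= M * ⟦v⟧) -> opnorm f <= M.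
Proof.
move=> M0 fM; apply: ge_sup; first by exists ⟦f 0⟧, 0 => //=; rewrite normr0.
move=> _ [v /= v1 <-]; apply: (le_trans (fM v)); rewrite -[leRHS]mulr1.
by rewrite ler_wpM2l//; move: v1; rewrite rnormE lecR.
Qed.

Lemma rnorm_le_opnorm (V W : normedModType R[i]) (f : V -> W) :
    bounded_map f -> (forall (t : R) v, f (t%:C *: v) = t%:C *: f v) ->
  0 <= opnorm f /\ forall v, ⟦f v⟧ <= opnorm f * ⟦v⟧.
Proof.
move=> /bounded_map_ex[M M0 fM] fZ.
have f_le v : ⟦v⟧ <= 1 -> ⟦f v⟧ <= opnorm f.
  move=> v1; apply: ub_le_sup; last by exists v => //=; rewrite rnormE lecR.
  exists M => _ [w /= w1 <-]; apply: (le_trans (fM w)); rewrite -[leRHS]mulr1.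
  by rewrite ler_wpM2l//; move: w1; rewrite rnormE lecR.
split; first by apply: le_trans (f_le 0 _); rewrite ?rnorm_ge0 ?rnorm0.
move=> v; have [v0|v0] := eqVneq ⟦v⟧ 0.
  by apply: (le_trans (fM v)); rewrite v0 !mulr0.
have {}v0 : 0 < ⟦v⟧ by rewrite lt_def v0 rnorm_ge0.
have vE u : ⟦⟦v⟧^-1%:C *: (u : V)⟧ = ⟦v⟧^-1 * ⟦u⟧.
  by rewrite rnormZr ger0_norm// invr_ge0 ltW.
have := f_le (⟦v⟧^-1%:C *: v); rewrite vE mulVf ?gt_eqF// => /(_ (lexx _)).
rewrite fZ rnormZr ger0_norm ?invr_ge0 ?(ltW v0)//.
by rewrite ler_pdivrMl// mulrC.
Qed.
End LinearMaps.

(** * The bound through phi *)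

Section PhiLinearBound.
Variables (R : realType) (B C : cstarAlgType R) (phi : B -> C).
Hypothesis phi_hom : is_star_hom phi.
Variables (E : hilbertModType B) (F : hilbertModType C) (a : E -> F).
Hypothesis a_lin : phi_linear phi a.

Lemma star_homD b c : phi (b + c) = phi b + phi c.
Proof.
by have [/linear_pack[g gE] _ _] := phi_hom; rewrite -!gE linearD.
Qed.

Lemma star_homZ (k : R[i]) b : phi (k *: b) = k *: phi b.
Proof.
by have [/linear_pack[g gE] _ _] := phi_hom; rewrite -!gE linearZ.
Qed.

Lemma star_homM b c : phi (b ** c) = phi b ** phi c.
Proof. by have [_ -> _] := phi_hom. Qed.

Lemma star_hom_star b : phi (cstar b) = cstar (phi b).
Proof. by have [_ _ ->] := phi_hom. Qed.

Lemma star_hom_csq j b : phi (csq j b) = csq j (phi b).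
Proof. by elim: j => // j IH; rewrite !csqS star_homM IH. Qed.

Lemma phi_linearB x y : a (x - y) = a x - a y.
Proof.
have [aD _] := a_lin.
have a0 : a 0 = 0 by apply: (addrI (a 0)); rewrite -aD !addr0.
rewrite aD; congr (_ + _); apply: (addrI (a y)).
by rewrite -aD !subrr.
Qed.

(** Additivity of [a] alone gives no complex scalars; writing [x = y b] moves the scalar into [B],
    where [phi] is linear. *)
Lemma phi_linearZ (k : R[i]) x : a (k *: x) = k *: a x.
Proof.
have [_ aact] := a_lin; have [y [b ->]] := hilbert_factorization x.
by rewrite -ractZr !aact star_homZ ractZr.
Qed.

(** Applying [phi] to [r = k^2 - k^2 r] gives [v <= u^2 + u^2 v] for [u = ‖phi k‖] and
    [v = ‖phi r‖]; as [u <= 1/2], the last term is absorbed on the left. *)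
Lemma rnorm_star_hom_resolvent k r : resolvent_of k r -> ⟦phi k⟧ <= 2^-1 ->
  ⟦phi r⟧ <= ⟦phi k⟧.
Proof.
move=> [_ _ rE _] k1.
have : ⟦phi r⟧ <= ⟦phi k⟧ * ⟦phi k⟧ + ⟦phi k⟧ * (⟦phi k⟧ * ⟦phi r⟧).
  have {1}-> : phi r = phi k ** phi k - phi k ** (phi k ** phi r).
    by rewrite -!star_homM -rE star_homD addrK.
  apply: (le_trans (rnormB _ _)); apply: lerD; first exact: rnorm_cmul.
  apply: (le_trans (rnorm_cmul _ _)); rewrite ler_wpM2l ?rnorm_ge0//.
  exact: rnorm_cmul.
have := rnorm_ge0 (phi k); have := rnorm_ge0 (phi r); move: k1.
move: ⟦phi k⟧ ⟦phi r⟧ => u v u1 v0 u0.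
have uu : u * u <= u * 2^-1 by rewrite ler_wpM2l.
have : u * u * v <= 4^-1 * v by apply: ler_wpM2r => //; lra.
by move=> *; lra.
Qed.

(* Cut [x] down to [x - x r] with [r] a resolvent of a high power of
   [⟨x, x⟩ / s], where [s > ‖phi ⟨x, x⟩‖]: its norm becomes at most [sqrt s],
   while [phi r] is small, so that [a (x - x r)] is still close to [a x]. *)
Lemma phi_linear_bound (M : R) x : 0 <= M -> (forall z, ⟦a z⟧ <= M * ⟦z⟧) ->
  ⟦a x⟧ ^+ 2 <= M ^+ 2 * ⟦phi ⟨x, x⟩⟧.
Proof.
move=> M0 aM; set h := ⟨x, x⟩; set q := ⟦phi h⟧; set A := ⟦a x⟧.
have q0 : 0 <= q := rnorm_ge0 _; have A0 : 0 <= A := rnorm_ge0 _.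
(* The strict inequality makes the powers of [q / s] tend to 0; afterwards [s] tends to [q]. *)
suff key s : q < s -> A ^+ 2 <= M ^+ 2 * s.
  rewrite -subr_le0; apply: (@le0_eps _ _ (M ^+ 2)); first exact: sqr_ge0.
  by move=> e e0; have := key (q + e); rewrite ltrDl => /(_ e0); lra.
move=> qs; have s0 : 0 < s := le_lt_trans q0 qs.
have qs1 : 0 <= q / s < 1.
  by rewrite divr_ge0 ?(ltW s0)//= ltr_pdivrMr// mul1r.
have step e : 0 < e -> e <= 2^-1 -> A <= M * Num.sqrt s + A * e.
  move=> e0 e1; have [j je] := expr_small qs1 e0.
  set k := csq j (s^-1%:C *: h).
  have ks : cstar k = k by rewrite csq_sa// cstarZr inner_sa.
  have [r kr] := resolvent_ex ks; have [_ rs _ _] := kr.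
  have ke : ⟦phi k⟧ <= e.
    rewrite /k star_hom_csq star_homZ; apply: (le_trans (rnorm_csq_le _ _)).
    rewrite rnormZr ger0_norm ?invr_ge0 ?(ltW s0)// mulrC.
    (* Since [j <= 2^j], the power of [q / s] with exponent [2^j] is at most the one with exponent
       [j]. *)
    apply: le_trans (ltW je); case/andP: qs1 => ? ?.
    by apply: ler_wiXn2l => //; [exact: ltW|exact/ltnW/ltn_expl].
  have re : ⟦phi r⟧ <= e.
    exact: (le_trans (rnorm_star_hom_resolvent kr (le_trans ke e1)) ke).
  have zs : ⟦x - x |> r⟧ <= Num.sqrt s.
    rewrite -(@ler_pXn2r _ 2)// ?nnegrE ?rnorm_ge0 ?sqrtr_ge0//.
    rewrite sqr_sqrtr ?(ltW s0)// rnorm_sub_ract//.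
    exact: (rnorm_cutoff (inner_sa x) s0 (erefl k) kr).
  have [_ aact] := a_lin.
  have aE : a (x - x |> r) = a x - a x |> phi r by rewrite phi_linearB aact.
  apply: (le_trans (rnorm_dist _ (a x |> phi r))); rewrite -aE; apply: lerD.
    by apply: (le_trans (aM _)); rewrite ler_wpM2l.
  by apply: (le_trans (rnorm_ract _ _)); rewrite ler_wpM2l.
suff : A <= M * Num.sqrt s.
  move=> AM; rewrite -[s in leRHS]sqr_sqrtr ?(ltW s0)// -exprMn.
  by rewrite ler_sqr ?nnegrE ?mulr_ge0 ?sqrtr_ge0.
rewrite -subr_le0; apply: (@le0_eps _ _ A) => // e e0.
have [e1|e1] := leP e 2^-1; first by have := step e e0 e1; lra.
have h0 : 0 < (2^-1 : R) by lra.
by have := step 2^-1 h0 (lexx _); nra.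
Qed.
End PhiLinearBound.

(** * The map on the tensor product *)

Section TensorMap.
Variables (R : realType) (B C : cstarAlgType R) (phi : B -> C).
Hypothesis phi_hom : is_star_hom phi.
Variables (E : hilbertModType B).

Lemma atensor_ext (W : lmodType R[i]) (f g : {linear atensor phi E -> W}) :
  (forall x c, f (tensor phi x c) = g (tensor phi x c)) -> f =1 g.
Proof.
move=> fg; elim/tsum_ind; elim=> [|[x c] s IH].
  by rewrite -[tsum _ _]/(0 : atensor phi E) !linear0.
by rewrite tsum_cons -[tadd _ _]/(_ + _ : atensor phi E) !linearD fg IH.
Qed.

(** Summing [(a x) c] over a formal sum respects every generator of [tensor_eq]: balancing over [B]
    is [phi]-linearity, and scalars pass by [phi_linearZ]. *)
Lemma phi_linear_lift (F : hilbertModType C) (a : E -> F) : phi_linear phi a ->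
  exists a' : {linear atensor phi E -> F},
    (forall x c, a' (tensor phi x c) = a x |> c) /\
    (forall t c, a' (t |> c) = a' t |> c).
Proof.
move=> a_lin; have [aD aact] := a_lin.
have aZ := phi_linearZ phi_hom a_lin.
pose f (s : seq (E * C)) : F := \sum_(p <- s) a p.1 |> p.2.
have fE x c : f [:: (x, c)] = a x |> c by rewrite /f big_seq1.
have a0 : a 0 = 0 by rewrite -(scale0r 0) aZ scale0r.
have f_eq s t : tensor_eq phi s t -> f s = f t.
  elim=> {s t} //.
  - by move=> t s u _ -> _ ->.
  - by move=> s s' t t' _ ss _ tt; rewrite /f !big_cat; congr (_ + _).
  - by move=> s t; rewrite /f !big_cat /= addrC.
  - by move=> c; rewrite fE a0 ract0l /f big_nil.
  - by move=> x y c; rewrite fE aD ractDl /f big_cons big_seq1.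
  - by move=> x c d; rewrite fE ractDr /f big_cons big_seq1.
  - by move=> k x c; rewrite !fE aZ ractZl ractZr.
  - by move=> x b c; rewrite !fE aact ractA.
pose g (t : atensor phi E) := f (repr t).
have gE s : g (tsum phi s) = f s by apply/f_eq/repr_tsum.
have g_lin : linear g.
  move=> k; elim/tsum_ind => s; elim/tsum_ind => t.
  rewrite -[k *: _ + _]/(tadd (tscale k _) _) tscale_tsum tadd_tsum !gE.
  rewrite /f big_cat /= big_map scaler_sumr; congr (_ + _).
  by apply: eq_bigr => p _ /=; rewrite aZ ractZl.
have [a' a'E] := linear_pack g_lin; exists a'; split=> [x c|t c].
  by rewrite a'E gE fE.
rewrite !a'E -[_ |> _]/(tact t c); elim/tsum_ind: t => s.
rewrite tact_tsum !gE /f big_map /=.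
elim: s => [|[x d] s IH]; first by rewrite !big_nil ract0l.
by rewrite !big_cons ractDl IH ractA.
Qed.
End TensorMap.

(** * The canonical map and the bounds for the induced operator *)

Section CanonicalMap.
Variables (R : realType) (B C : cstarAlgType R) (phi : B -> C).
Hypothesis phi_hom : is_star_hom phi.
Variables (E : hilbertModType B).
Variables (H : hilbertModType C) (iota : {linear atensor phi E -> H}).
Hypothesis H_tensor : is_interior_tensor iota.
Variable i_phi : E -> atensor phi E.
Hypothesis i_phi_can : is_canonical_map i_phi.

(** In inner products [i_phi x] behaves like [x ⊗ 1]: for [x = y b] the factor [phi b] is absorbed
    into [phi ⟨w, y⟩]. *)
Lemma inner_tensor_canonical w c x :
  ⟨iota (tensor phi w c), iota (i_phi x)⟩ = cstar c ** phi ⟨w, x⟩.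
Proof.
have [y [b ->]] := hilbert_factorization x.
by rewrite i_phi_can (interior_inner H_tensor) -cmulA -star_homM// inner_ract.
Qed.

Lemma inner_canonical x y : ⟨iota (i_phi x), iota (i_phi y)⟩ = phi ⟨x, y⟩.
Proof.
have [z [b ->]] := hilbert_factorization x.
rewrite i_phi_can inner_tensor_canonical -star_hom_star// -star_homM//.
by rewrite inner_ractl.
Qed.

Lemma rnorm_canonical x : ⟦iota (i_phi x)⟧ ^+ 2 = ⟦phi ⟨x, x⟩⟧.
Proof. by rewrite -rnorm_inner inner_canonical. Qed.

(** Different vectors factor through different elements of [B], so linearity is read off inner
    products: the defect [D] is orthogonal to every [i_phi z] and is itself a combination of such
    vectors. *)
Lemma canonical_linear : linear i_phi.
Proof.
move=> k x y; apply: (interior_inj H_tensor); rewrite linearP.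
apply/eqP; rewrite -subr_eq0; set D := _ - _; apply/eqP/rnorm_eq0.
have zD z : ⟨iota (i_phi z), D⟩ = 0.
  rewrite /D innerBr innerDr innerZr !inner_canonical innerDr innerZr.
  by rewrite star_homD// star_homZ// subrr.
have : ⟦D⟧ ^+ 2 = 0.
  rewrite -rnorm_inner {1}/D innerBl innerDl innerZl !zD.
  by rewrite scaler0 addr0 subrr rnorm0.
by move/eqP; rewrite sqrf_eq0 => /eqP.
Qed.

(** For [x = y b] the ideal property gives [phi b c = phi b'], so
    [x ⊗ c = y ⊗ phi b' = i_phi (y b')]; additivity of [i_phi] handles sums. *)
Lemma canonical_surj_of_ideal : two_sided_ideal (range phi) ->
  forall t, exists x, i_phi x = t.
Proof.
move=> [_ _ _ idl].
have [i iE] := linear_pack canonical_linear.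
elim/tsum_ind; elim=> [|[x c] s [z zE]]; first by exists 0; rewrite -iE linear0.
have [y [b ->]] := hilbert_factorization x.
have [_ [b' _ b'E]] : range phi (phi b ** c) /\ range phi (phi b ** c).
  by have [] := idl (phi b) c; first by exists b.
exists (y |> b' + z); rewrite -iE linearD !iE zE i_phi_can b'E -tensorB.
by rewrite tsum_cons.
Qed.

Variables (F : hilbertModType C) (a : E -> F).
Hypothesis a_lin : phi_linear phi a.
Variable a' : {linear atensor phi E -> F}.
Hypothesis a'E : forall x c, a' (tensor phi x c) = a x |> c.
Variable M : R.
Hypothesis M0 : 0 <= M.
Hypothesis aM : forall x, ⟦a x⟧ <= M * ⟦x⟧.

Lemma lift_canonical x : a x = a' (i_phi x).
Proof.
have [y [b ->]] := hilbert_factorization x; have [_ aact] := a_lin.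
by rewrite i_phi_can a'E aact.
Qed.

Lemma rnorm_lift_canonical x : ⟦a x⟧ <= M * ⟦iota (i_phi x)⟧.
Proof.
rewrite -(@ler_pXn2r _ 2)// ?nnegrE ?mulr_ge0 ?rnorm_ge0//.
by rewrite exprMn rnorm_canonical; exact: phi_linear_bound.
Qed.

Lemma inner_lift_adjoint (S : F -> E) :
    (forall x y, ⟨a x, y⟩ = phi ⟨x, S y⟩) ->
  forall t y, ⟨a' t, y⟩ = ⟨iota t, iota (i_phi (S y))⟩.
Proof.
move=> aS t y; elim/tsum_ind: t; elim=> [|[x c] s IH].
  by rewrite -[tsum _ _]/(0 : atensor phi E) !linear0 !inner0l.
rewrite tsum_cons -[tadd _ _]/(_ + _ : atensor phi E) !linearD !innerDl IH.
by rewrite a'E inner_ractl aS inner_tensor_canonical.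
Qed.

(** First [‖i_phi (S y)‖^2 = ‖⟨a (S y), y⟩‖ <= M ‖i_phi (S y)‖ ‖y‖] bounds the adjoint; then
    Cauchy-Schwarz in [H] transfers the bound to [a']. *)
Lemma rnorm_lift_adjointable : phi_adjointable phi a ->
  forall t, ⟦a' t⟧ <= M * ⟦iota t⟧.
Proof.
move=> [S aS] t; have := inner_lift_adjoint aS => a'S.
have Sb y : ⟦iota (i_phi (S y))⟧ <= M * ⟦y⟧.
  set u := iota _; apply: le_of_sqr_le_mul; rewrite ?mulr_ge0 ?rnorm_ge0//.
  rewrite rnorm_canonical -aS; apply: (le_trans (rnorm_inner_le _ _)).
  by rewrite mulrA (mulrC ⟦u⟧) ler_wpM2r ?rnorm_ge0// rnorm_lift_canonical.
apply: le_of_sqr_le_mul; rewrite ?mulr_ge0 ?rnorm_ge0//.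
rewrite -rnorm_inner a'S; apply: (le_trans (rnorm_inner_le _ _)).
by rewrite mulrC mulrA (mulrC ⟦a' t⟧) ler_wpM2r ?rnorm_ge0.
Qed.

Lemma rnorm_lift_ideal : two_sided_ideal (range phi) ->
  forall t, ⟦a' t⟧ <= M * ⟦iota t⟧.
Proof.
move=> /canonical_surj_of_ideal surj t; have [x <-] := surj t.
by rewrite -lift_canonical rnorm_lift_canonical.
Qed.
End CanonicalMap.

Theorem proposition1p11 (R : realType) (B C : cstarAlgType R)
    (phi : B -> C) (phi_hom : is_star_hom phi) (phi_nd : nondegenerate_hom phi)
    (E : hilbertModType B) (F : hilbertModType C)
    (H : hilbertModType C) (iota : {linear atensor phi E -> H})
    (H_tensor : is_interior_tensor iota)
    (i_phi : E -> atensor phi E) (i_phi_can : is_canonical_map i_phi)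
    (a : E -> F) (a_lin : phi_linear phi a) (a_bd : bounded_map a) :
  exists a' : {linear atensor phi E -> F},
    [/\ (forall x c, a' (tensor phi x c) = a x |> c)
          /\ (forall b : {linear atensor phi E -> F},
                (forall x c, b (tensor phi x c) = a x |> c) -> b =1 a'),
        (forall t c, a' (t |> c) = a' t |> c),
        (forall x, a x = a' (i_phi x)),
        ((forall t, exists x, i_phi x = t) ->
           forall b : atensor phi E -> F,
             (forall x, a x = b (i_phi x)) -> b =1 a')
      & (phi_adjointable phi a \/ two_sided_ideal (range phi)) ->
        exists A : {linear H -> F},
          [/\ (forall t, A (iota t) = a' t),
              (forall z c, A (z |> c) = A z |> c),
              bounded_map A,
              opnorm A <= opnorm a
            & phi_adjointable phi a ->
              phi_adjointable (fun c : C => c) A]].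
Proof.
have [a' [a'E a'act]] := phi_linear_lift phi_hom a_lin.
have a'i := lift_canonical i_phi_can a_lin a'E.
have [|M0 aM] := rnorm_le_opnorm a_bd.
  by move=> t v; rewrite (phi_linearZ phi_hom a_lin).
exists a'; split=> //.
- by split=> // b bE; apply: atensor_ext => x c; rewrite bE a'E.
- by move=> surj b bE t; have [x <-] := surj t; rewrite -bE a'i.
move=> adj_or_ideal.
have a'M t : ⟦a' t⟧ <= opnorm a * ⟦iota t⟧.
  case: adj_or_ideal => [adj|idl].
  - exact: (rnorm_lift_adjointable phi_hom H_tensor i_phi_can a_lin a'E).
  - exact: (rnorm_lift_ideal phi_hom H_tensor i_phi_can a_lin a'E).
have dH := interior_dense H_tensor.
have [A [AE AM]] := dense_extend M0 dH a'M.
have ABM z w : ⟦A z - A w⟧ <= opnorm a * ⟦z - w⟧ by rewrite -linearB.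
exists A; split=> //.
- move=> z c.
  (* Both sides are Lipschitz in [z] and agree on the dense range of [iota]. *)
  apply: (@dense_eq _ _ _ (range iota) (fun z => A (z |> c)) (fun z => A z |> c)
            (opnorm a * ⟦c⟧)) => //.
  + move=> u v; apply: (le_trans (ABM _ _)); rewrite -ractBl -mulrA ler_wpM2l//.
    by rewrite mulrC rnorm_ract.
  + move=> u v; rewrite -ractBl; apply: (le_trans (rnorm_ract _ _)).
    by rewrite mulrAC ler_wpM2r ?rnorm_ge0.
  + by move=> _ [t _ <-]; rewrite -(interior_act H_tensor) !AE a'act.
- exact: bounded_map_rnorm AM.
- exact: opnorm_le.
move=> [S aS].
have [i iE] := linear_pack (canonical_linear phi_hom H_tensor i_phi_can).
exists (iota \o i \o S) => z y /=; rewrite iE.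
(* The sum of the two Lipschitz constants serves for both sides. *)
apply: (@dense_eq _ _ _ (range iota) (fun z => ⟨A z, y⟩)
          (fun z => ⟨z, iota (i_phi (S y))⟩)
          (opnorm a * ⟦y⟧ + ⟦iota (i_phi (S y))⟧)) => //.
- move=> u v; rewrite -innerBl; apply: (le_trans (rnorm_inner_le _ _)).
  rewrite mulrDl mulrAC; apply: (@le_trans _ _ (opnorm a * ⟦u - v⟧ * ⟦y⟧)).
    by rewrite ler_wpM2r ?rnorm_ge0.
  by rewrite lerDl mulr_ge0 ?rnorm_ge0.
- move=> u v; rewrite -innerBl; apply: (le_trans (rnorm_inner_le _ _)).
  by rewrite mulrC ler_wpM2r ?rnorm_ge0// lerDr mulr_ge0 ?rnorm_ge0.
- move=> _ [t _ <-]; rewrite AE.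
  exact: (inner_lift_adjoint phi_hom H_tensor i_phi_can a'E aS).
Qed.
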